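(* Let $(\mathcal G=(V,E),(W_e)_{e\in E})$ be a graph with conductances. There exists a unique probability distribution $\nu_V^W$ on $(\mathcal D_V^W,\mathcal B(\mathcal D_V^W))$ such that for any finite subset $U\subset V$ and any $(\lambda_i)_{i\in U}\in\mathbb R_+^U$, $$\int e^{-\sum_{i\in U}\lambda_i\beta_i}\,\nu_V^W(d\beta)=e^{-\sum_{i\sim j,\ i,j\in U}W_{i,j}(\sqrt{(1+\lambda_i)(1+\lambda_j)}-1)-\sum_{i\sim j,\ i\in U,\,j\notin U}W_{i,j}(\sqrt{1+\lambda_i}-1)}\,\frac1{\prod_{i\in U}\sqrt{1+\lambda_i}}.$$ In particular, on the probability space $(\mathcal D_V^W,\mathcal B(\mathcal D_V^W),\nu_V^W(d\beta))$: (1-dependence) if $U,U'\subset V$ are such that $\mathrm d_{\mathcal G}(U,U')\ge2$, then the random variables $\beta\mapsto\beta_U$ and $\beta\mapsto\beta_{U'}$ are independent; (Reciprocal inverse Gaussian marginals) for $i\in V$, the random variable $\beta\mapsto\frac1{2\beta_i}$ has an inverse Gaussian distribution with parameters $(\frac1{W_i},1)$, where $W_i=\sum_{j\sim i}W_{i,j}$.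
   Context: Graph with conductances: $\mathcal G=(V,E)$ is an undirected, locally finite, connected graph (finite or infinite) without loops or multiple edges; $i\sim j$ means $\{i,j\}\in E$; each edge carries a conductance $W_{i,j}=W_{j,i}>0$. Sums $\sum_{i\sim j}$ over edges count each undirected edge once. $\mathrm d_{\mathcal G}$ is the graph distance and $\mathrm d_{\mathcal G}(U,U')=\inf_{i\in U,j\in U'}\mathrm d_{\mathcal G}(i,j)$. For $\beta\in\mathbb R^V$, $\beta_U=(\beta_i)_{i\in U}$. $P_{i,j}=W_{i,j}$ if $i\sim j$ and $0$ otherwise; $H_\beta=-P+2\beta$, with $\beta$ acting as the diagonal (multiplication) operator. $\mathcal D_V^W=\{\beta\in\mathbb R^V:(H_\beta)_{U,U}\text{ is positive definite for all finite }U\subset V\}$, where $(H_\beta)_{U,U}$ is the restriction to $U\times U$; $\mathcal B(\mathcal D_V^W)$ is its Borel $\sigma$-field. The inverse Gaussian distribution with parameters $(\mu,\lambda)$ has density $\sqrt{\lambda/(2\pi x^3)}\,\exp(-\lambda(x-\mu)^2/(2\mu^2x))$ on $x>0$. *)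

(* Defs.v *)
From HB Require Import structures.
From mathcomp Require Import all_boot all_order all_algebra.
From mathcomp Require Import finmap ring lra.
From mathcomp Require Import all_classical all_reals all_analysis.
Import numFieldNormedType.Exports.

Set Implicit Arguments.
Unset Strict Implicit.
Unset Printing Implicit Defensive.
Import Order.TTheory GRing.Theory Num.Theory.
Local Open Scope fset_scope.
Local Open Scope classical_set_scope.
Local Open Scope ring_scope.

(* An edge is a two-element set of vertices, so that the graph is undirected,
   without loops or multiple edges. *)
Record graph (V : choiceType) := Graph {
  edge : pred {fset V};
  edge_card2 : forall e, edge e -> #|` e| = 2%N;
  edge_locally_finite : forall i, finite_set [set j | edge [fset i; j]];
  edge_connected : forall i j, exists p,
    path (fun k l => edge [fset k; l]) i p /\ last i p = j }.

Section Graph.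
Variables (V : choiceType) (G : graph V).

Definition adj : rel V := fun i j => edge G [fset i; j].

(* Distances live in \bar R, so that the infimum over an empty family is +oo. *)
Definition dist (R : realType) (i j : V) : \bar R :=
  ereal_inf [set (size p)%:R%:E | p in [set p | path adj i p /\ last i p = j]].

Definition set_dist (R : realType) (U U' : set V) : \bar R :=
  ereal_inf [set dist R i j | i in U & j in U'].

End Graph.

Section Schrodinger.
Variables (R : realType) (V : choiceType) (G : graph V).

(* W_{i,j} is [W [fset i; j]]; the values of W outside the edges of G are
   never used. *)
Variable W : {fset V} -> R.

Definition conductance_op (i j : V) : R :=
  if adj G i j then W [fset i; j] else 0.

Definition schrodinger_op (b : V -> R) (i j : V) : R :=
  - conductance_op i j + (2 * b i) *+ (i == j).

Definition positive_definite_on (U : {fset V}) (M : V -> V -> R) : Prop :=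
  forall x : U -> R, (exists i, x i != 0) ->
    0 < \sum_(i : U) \sum_(j : U) x i * M (val i) (val j) * x j.

Definition DV_set : set {ptws V -> R} :=
  [set b | forall U : {fset V}, positive_definite_on U (schrodinger_op b)].

(* The domain D_V^W as a type, with the topology induced by the product
   topology of R^V. *)
Definition DV : Type := DV_set.

HB.instance Definition _ := Topological.on DV.

Local Lemma sum_conductance_op_le (U : {fset V}) (i : V) :
  \sum_(j : U) `|conductance_op i (val j)| <=
  \sum_(j <- fset_set [set j | adj G i j]) `|conductance_op i j|.
Proof.
set N := fset_set _.
rewrite -(big_seq_fsetE _ U predT (fun j => `|conductance_op i j|)) /=.
have UN : (U `<=` U `|` N)%fset by apply: fsubsetUl.
have NU : (N `<=` U `|` N)%fset by apply: fsubsetUr.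
rewrite (big_fset_incl _ NU) /=; last first.
  move=> j _; rewrite in_fset_set ?inE; last exact: edge_locally_finite.
  by rewrite notin_setE /= /conductance_op => /negP/negbTE ->; rewrite normr0.
rewrite (big_fsetID _ (mem U) (U `|` N)%fset) /=.
rewrite (_ : [fset x in (U `|` N)%fset | x \in U] = U); last first.
  by apply/fsetP => x; rewrite !inE; case: (x \in U); rewrite ?andbF.
by rewrite lerDl sumr_ge0.
Qed.

Local Lemma DV_set_nonempty : exists b, b \in DV_set.
Proof.
pose c i := \sum_(j <- fset_set [set j | adj G i j]) `|conductance_op i j|.
exists (fun i => (1 + c i) / 2); apply/mem_set => U x [i0 xi0].
have sumE : \sum_(i : U) \sum_(j : U)
    x i * schrodinger_op (fun i => (1 + c i) / 2) (val i) (val j) * x j =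
    \sum_(i : U) (1 + c (val i)) * x i ^+ 2 -
    \sum_(i : U) \sum_(j : U) x i * conductance_op (val i) (val j) * x j.
  rewrite -sumrB; apply: eq_bigr => i _.
  rewrite (bigD1 i) //= [in RHS](bigD1 i) //= opprD addrA; congr (_ + _).
    by rewrite /schrodinger_op eqxx mulr1n; field.
  rewrite -sumrN; apply: eq_bigr => j ji.
  rewrite /schrodinger_op -val_eqE /= in ji *.
  by rewrite eq_sym (negbTE ji) mulr0n addr0 mulrN mulNr.
pose a (i j : U) := `|conductance_op (val i) (val j)|.
have aC i j : a i j = a j i.
  by rewrite /a /conductance_op /adj fsetUC.
have le1 : \sum_(i : U) \sum_(j : U)
      x i * conductance_op (val i) (val j) * x j <=
    \sum_(i : U) \sum_(j : U) (a i j * x i ^+ 2 / 2 + a i j * x j ^+ 2 / 2).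
  apply: ler_sum => i _; apply: ler_sum => j _.
  apply: (le_trans (ler_norm _)); rewrite !normrM -/(a i j).
  rewrite -(real_normK (num_real (x i))) -(real_normK (num_real (x j))).
  have a0 : 0 <= a i j by exact: normr_ge0.
  have := mulr_ge0 a0 (sqr_ge0 (`|x i| - `|x j|)).
  by nra.
have le2 : \sum_(i : U) \sum_(j : U)
      (a i j * x i ^+ 2 / 2 + a i j * x j ^+ 2 / 2) <=
    \sum_(i : U) c (val i) * x i ^+ 2.
  under eq_bigr do rewrite big_split /=.
  rewrite big_split /= [X in _ + X]exchange_big /= -big_split /=.
  apply: ler_sum => i _; rewrite -big_split /=.
  under eq_bigr => j _ do rewrite (aC j i) -splitr.
  rewrite -mulr_suml ler_wpM2r ?sqr_ge0 //; exact: sum_conductance_op_le.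
have le3 : \sum_(i : U) c (val i) * x i ^+ 2 <
    \sum_(i : U) (1 + c (val i)) * x i ^+ 2.
  rewrite -subr_gt0 -sumrB.
  under eq_bigr => i _ do rewrite mulrDl mul1r addrK.
  rewrite (bigD1 i0) //= ltr_pwDl ?exprn_even_gt0 ?xi0 ?orbT //.
  by apply: sumr_ge0 => i _; exact: sqr_ge0.
by rewrite sumE subr_gt0 (le_lt_trans le1) // (le_lt_trans le2).
Qed.

(* The library requires measurable types to be pointed. *)
Definition DV_point : DV :=
  let b := cid DV_set_nonempty in exist _ (sval b) (svalP b).

HB.instance Definition _ := isPointed.Build DV DV_point.

End Schrodinger.

(* The Borel sigma-algebra *)
Notation borel T := (g_sigma_algebraType (@open T)).

Section Law.
Variables (R : realType) (V : choiceType) (G : graph V) (W : {fset V} -> R).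

(* In the first sum each edge {i,j} inside U occurs once, and the product over
   its two endpoints is (1 + lam i) * (1 + lam j). *)
Definition laplace_nu (U : {fset V}) (lam : V -> R) : R :=
  expR (- (\sum_(e <- fpowerset U | edge G e)
             W e * (Num.sqrt (\prod_(k <- e) (1 + lam k)) - 1))
        - \sum_(i <- U) \sum_(j \in [set j | adj G i j /\ j \notin U])
             W [fset i; j] * (Num.sqrt (1 + lam i) - 1))
  * (\prod_(i <- U) Num.sqrt (1 + lam i))^-1.

Definition has_laplace_nu (nu : probability (borel (DV G W)) R) : Prop :=
  forall (U : {fset V}) (lam : V -> R), (forall i, i \in U -> 0 <= lam i) ->
    (\int[nu]_b (expR (- \sum_(i <- U) lam i * val b i))%:E =
     (laplace_nu U lam)%:E)%E.

Definition total_conductance (i : V) : R :=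
  \sum_(j \in [set j | adj G i j]) W [fset i; j].

Definition restriction (U : set V) (b : borel (DV G W)) :
    borel {ptws U -> R} := fun i => val b (val i).

End Law.

Definition independent_rv d d1 d2 (T : measurableType d)
    (T1 : measurableType d1) (T2 : measurableType d2) (R : realType)
    (P : probability T R) (X : T -> T1) (Y : T -> T2) : Prop :=
  [/\ measurable_fun setT X, measurable_fun setT Y &
   forall A B, measurable A -> measurable B ->
     (P (X @^-1` A `&` Y @^-1` B) = P (X @^-1` A) * P (Y @^-1` B))%E].

(* The parameter mu ranges over ]0, +oo]; at mu = +oo the density is the limit
   as mu tends to +oo.  This case occurs below only for a graph reduced to a
   single vertex, where 1 / W_i = 1 / 0. *)
Definition inverse_gaussian_pdf (R : realType) (mu : \bar R) (lam x : R) : R :=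
  if x <= 0 then 0 else
  Num.sqrt (lam / (2 * pi * x ^+ 3)) *
  match mu with
  | m%:E => expR (- (lam * (x - m) ^+ 2 / (2 * m ^+ 2 * x)))
  | +oo%E => expR (- (lam / (2 * x)))
  | -oo%E => 0
  end.

Definition has_inverse_gaussian_law d (T : measurableType d) (R : realType)
    (P : probability T R) (X : T -> measurableTypeR R)
    (mu : \bar R) (lam : R) : Prop :=
  measurable_fun setT X /\
  forall A : set (measurableTypeR R), measurable A ->
    (pushforward P X A =
     \int[lebesgue_measure]_(x in A) (inverse_gaussian_pdf mu lam x)%:E)%E.

(* Main.v *)
(* Existence.  Enumerate the vertices and eliminate them one after the other.
   At step n, sample the Green function x_n of vertex n from the inverse
   Gaussian density with parameter the total reduced conductance from n to the
   later vertices, then add to the conductances the rank-one term produced by the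
   Schur complement.  The potential beta is recovered from x by an LDL^T
   decomposition with pivots 1 / x_n, hence H_beta is positive definite.
   Tilting an inverse Gaussian density by its Laplace weight gives a multiple of
   another one, so the conditional Laplace transforms form an explicit
   martingale, whose value at time 0 is the announced formula.  The projective
   limit of the finite-dimensional laws is obtained by coding the countably many
   tests [a < x_n] with nested subintervals of [0, 1[.

   Uniqueness, independence, marginals.  Integer points of the Laplace transform
   determine the probabilities of the boxes {a_i < beta_i}, through the functions
   (1 - e^(-n x))^N with N = N(n, a), which converge to the indicator of a < x.
   Independence then follows from the factorization of the Laplace transform
   over sets of vertices at distance at least 2. *)
Require Import Defs.
From HB Require Import structures.
From mathcomp Require Import all_boot all_order all_algebra.
From mathcomp Require Import finmap ring lra.
From mathcomp Require Import all_classical all_reals all_analysis.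
From mathcomp Require Import measurable_realfun.
Import numFieldNormedType.Exports.
Set Implicit Arguments.
Unset Strict Implicit.
Unset Printing Implicit Defensive.
Import Order.TTheory GRing.Theory Num.Theory.
Local Open Scope fset_scope.
Local Open Scope classical_set_scope.
Local Open Scope ring_scope.

(** The obstacle is an infinite graph: no last vertex is available from which to normalize a joint
    density. Eliminating from the first vertex on avoids it: the law of x_n given the past only
    needs the conductance from n to all later vertices, a finite sum by local finiteness, and a new
    step leaves the earlier coordinates alone, so the finite-dimensional laws are consistent by
    construction. The martingale is explicit for an algebraic reason. With lambda_i = s_i^2 - 1, the
    Laplace exponent is half the sum of w_ij (s_i s_j - 1) over ordered pairs. The rank-one update
    changes this sum by an affine function of x_n, while beta_n contributes a multiple of 1 / x_n:
    these are exactly the two tilts that preserve the family [igf]. Integer points of the Laplace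
    transform suffice because the 1 x 1 minors of H_beta force beta_i > 0 on the domain, so that
    each e^(-beta_i) lies in ]0, 1[. The Borel sets are reached from boxes because V is countable,
    by connectedness and local finiteness. *)

(** * Total mass of the inverse Gaussian density *)

Section Phi.
Variable R : realType.

Definition Phi (y : R) : R := \int[lebesgue_measure]_(t in `]-oo, y]) normal_pdf 0 1 t.

Definition phi (y : R) : R := normal_peak 1 * expR (- y ^+ 2 / 2).

Lemma phiE y : normal_pdf 0 1 y = phi y.
Proof.
by rewrite normal_pdfE ?oner_eq0// /phi /normal_fun subr0 expr1n mulr2n.
Qed.

Lemma Phi_derive (y : R) : is_derive y 1 Phi (phi y).
Proof.
have [||||d1 d2] := @continuous_FTC1 R (normal_pdf 0 1) (BInfty _ true) y (y + 1).
- by rewrite ltrDl.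
- apply: (integrableS _ _ (subsetT _)) => //; exact: integrable_normal_pdf.
- exact: ltNyr.
- apply: continuous_normal_pdf; exact: oner_neq0.
by apply: DeriveDef => //; rewrite -derive1E d2 phiE.
Qed.

Let idR : measurableTypeR R -> R := idfun.

#[local] HB.instance Definition _ :=
  @isMeasurableFun.Build _ _ _ _ idR (@measurable_id _ _ setT).

Lemma Phi_cdf :
  Phi = fine \o cdf (idR : {RV (normal_prob 0 1 : probability _ R) >-> R}).
Proof. by []. Qed.

Lemma Phi_y : Phi y @[y --> +oo] --> (1 : R).
Proof. by rewrite Phi_cdf; apply: fine_cvg; exact: cvg_cdfy1. Qed.

Lemma Phi_Ny : Phi y @[y --> -oo] --> (0 : R).
Proof. by rewrite Phi_cdf; apply: fine_cvg; exact: cvg_cdfNy0. Qed.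

(* The antiderivative of [igf] below; up to a factor and an additive constant,
   the classical formula for the inverse Gaussian distribution function. *)
Definition igF (b s x : R) : R :=
  s^-1 * (Phi (b * Num.sqrt x - s / Num.sqrt x) -
          expR (2 * b * s) * Phi (b * Num.sqrt x + s / Num.sqrt x)).

(* For b, s > 0 this is 1 / s times the inverse Gaussian density of parameters
   (s / b, s ^ 2); the form allows b = 0. *)
Definition igf (b s x : R) : R := if x <= 0 then 0 else
  Num.sqrt (1 / (2 * pi * x ^+ 3)) * expR (- ((b * x - s) ^+ 2 / (2 * x))).

Lemma normal_peak_sqrt (x : R) : 0 < x ->
  Num.sqrt (1 / (2 * pi * x ^+ 3)) = normal_peak 1 * (Num.sqrt x)^-1 ^+ 3.
Proof.
move=> x0; rewrite /normal_peak expr1n !mul1r sqrtrV; last first.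
  by rewrite !mulr_ge0 ?pi_ge0 ?exprn_ge0 // ltW.
have p0 : 0 <= pi *+ 2 :> R by rewrite mulrn_wge0 ?pi_ge0.
rewrite mulr_natl (sqrtrM _ p0) invfM; congr (_ * _).
rewrite exprVn; congr (_ ^-1).
rewrite -{1}[x]sqr_sqrtr ?ltW // -exprM mulnC exprM sqrtr_sqr ger0_norm // exprn_ge0.
Qed.

(** With u and v the two arguments of [Phi] (minus and plus sign), the identity v^2 - u^2 = 4 b s
    gives e^(2 b s) phi(v) = phi(u). The derivative collapses to phi(u) (u' - v') / s, where u' - v'
    = s x^(-3/2). *)
Lemma is_derive_igF (b s x : R) : 0 < s -> 0 < x ->
  is_derive x 1 (igF b s) (igf b s x).
Proof.
move=> s0 x0; rewrite /igf leNgt x0 /=.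
have r0 : 0 < Num.sqrt x by rewrite sqrtr_gt0.
have dr := is_derive1_sqrt x0.
have dV : is_derive x 1 (fun x : R => (Num.sqrt x)^-1)
    (- (Num.sqrt x) ^- 2 * (2 * Num.sqrt x)^-1).
  by apply: is_deriveV => //; rewrite gt_eqF.
have du : is_derive x 1 (fun x : R => b * Num.sqrt x - s / Num.sqrt x)
   (b * (2 * Num.sqrt x)^-1 - s * (- (Num.sqrt x) ^- 2 * (2 * Num.sqrt x)^-1)).
  by apply: is_deriveB; apply: is_deriveZ.
have dv : is_derive x 1 (fun x : R => b * Num.sqrt x + s / Num.sqrt x)
   (b * (2 * Num.sqrt x)^-1 + s * (- (Num.sqrt x) ^- 2 * (2 * Num.sqrt x)^-1)).
  by apply: is_deriveD; apply: is_deriveZ.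
have dPu := is_derive1_comp (Phi_derive _) du.
have dPv := is_derive1_comp (Phi_derive _) dv.
have dF := is_deriveZ s^-1 (is_deriveB dPu (is_deriveZ (expR (2 * b * s)) dPv)).
have -> : igF b s = s^-1 *: ((@Phi \o (fun x : R => b * Num.sqrt x - s / Num.sqrt x)) -
   expR (2 * b * s) *: (@Phi \o (fun x : R => b * Num.sqrt x + s / Num.sqrt x))) by [].
apply: is_derive_eq dF _.
rewrite normal_peak_sqrt // /phi /GRing.scale /=.
set r := Num.sqrt x in r0 *.
have xr : x = r ^+ 2 by rewrite sqr_sqrtr ?ltW.
have e1 : expR (- (b * r + s / r) ^+ 2 / 2) =
    expR (- ((b * x - s) ^+ 2 / (2 * x))) / expR (2 * b * s).
  rewrite -expRN -expRD; congr expR; rewrite xr; field; rewrite gt_eqF //.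
have e2 : expR (- (b * r - s / r) ^+ 2 / 2) =
    expR (- ((b * x - s) ^+ 2 / (2 * x))).
  congr expR; rewrite xr; field; rewrite gt_eqF //.
rewrite e1 e2; field.
by rewrite !gt_eqF ?expR_gt0.
Qed.

Lemma sqrtr_le (x c : R) : 0 <= c -> x <= c ^+ 2 -> Num.sqrt x <= c.
Proof.
by move=> c0 /ler_wsqrtr; rewrite sqrtr_sqr ger0_norm.
Qed.

Lemma le_sqrtr (x c : R) : 0 <= c -> c ^+ 2 <= x -> c <= Num.sqrt x.
Proof.
by move=> c0 /ler_wsqrtr; rewrite sqrtr_sqr ger0_norm.
Qed.

Lemma igF_arg_cvgNy (b s : R) : 0 <= b -> 0 < s ->
  b * Num.sqrt x - s / Num.sqrt x @[x --> 0^'+] --> -oo.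
Proof.
move=> b0 s0; apply/cvgrNyPle => A.
(* For x < 1 the first term is at most b, so it suffices that s / sqrt x be at least b + |A|; sqrt x
   <= c gives this with a margin of 1. *)
pose c := s / (b + `|A| + 1).
have c0 : 0 < c by rewrite divr_gt0 // ltr_wpDl // addr_ge0.
near=> x.
have x0 : 0 < x by near: x; exact: nbhs_right_gt.
have x1 : x < 1 by near: x; exact: nbhs_right_lt.
have xc : x < c ^+ 2 by near: x; apply: nbhs_right_lt; rewrite exprn_gt0.
have r0 : 0 < Num.sqrt x by rewrite sqrtr_gt0.
have r1 : Num.sqrt x <= 1 by apply: sqrtr_le; rewrite ?expr1n // ltW.
have rc : Num.sqrt x <= c.
  by apply: sqrtr_le; exact: ltW.
have : b + `|A| + 1 <= s / Num.sqrt x.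
  by rewrite ler_pdivlMr // mulrC -ler_pdivlMr // ltr_wpDl // addr_ge0.
have := ler_wpM2l b0 r1.
have := ler_norm (- A); rewrite normrN; lra.
Unshelve. all: by end_near. Qed.

Lemma igF_arg_cvgy (b s : R) : 0 <= b -> 0 < s ->
  b * Num.sqrt x + s / Num.sqrt x @[x --> 0^'+] --> +oo.
Proof.
move=> b0 s0; apply/cvgryPge => A.
pose c := s / (`|A| + 1).
have c0 : 0 < c by rewrite divr_gt0 // ltr_wpDl.
near=> x.
have x0 : 0 < x by near: x; exact: nbhs_right_gt.
have xc : x < c ^+ 2 by near: x; apply: nbhs_right_lt; rewrite exprn_gt0.
have r0 : 0 < Num.sqrt x by rewrite sqrtr_gt0.
have rc : Num.sqrt x <= c.
  by apply: sqrtr_le; exact: ltW.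
have : `|A| + 1 <= s / Num.sqrt x.
  by rewrite ler_pdivlMr // mulrC -ler_pdivlMr // ltr_wpDl.
have := mulr_ge0 b0 (ltW r0).
have := ler_norm A; lra.
Unshelve. all: by end_near. Qed.

Lemma igF_arg_cvgy_pinfty (b s : R) : 0 < b ->
  b * Num.sqrt x + s / Num.sqrt x @[x --> +oo] --> +oo.
Proof.
move=> b0; apply/cvgryPge => A.
pose c := (`|A| + `|s|) / b.
have c0 : 0 <= c by rewrite divr_ge0 ?addr_ge0 // ltW.
near=> x.
have x1 : 1 < x by near: x; exact: nbhs_pinfty_gt.
have xc : c ^+ 2 < x by near: x; apply: nbhs_pinfty_gt; exact: num_real.
have r1 : 1 <= Num.sqrt x by apply: le_sqrtr; rewrite ?expr1n // ltW.
have r0 : 0 < Num.sqrt x by rewrite (lt_le_trans _ r1).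
have rc : c <= Num.sqrt x.
  by apply: le_sqrtr => //; exact: ltW.
have : `|A| + `|s| <= b * Num.sqrt x by rewrite mulrC -ler_pdivrMr.
have : `|s / Num.sqrt x| <= `|s|.
  by rewrite normrM normfV (gtr0_norm r0) ler_piMr // invf_le1.
have := ler_norm (- (s / Num.sqrt x)); rewrite normrN.
have := ler_norm A; lra.
Unshelve. all: by end_near. Qed.

(** Both arguments of [Phi] tend to +oo when b > 0. When b = 0 they tend to 0 instead and the two
    values of [Phi] cancel, in agreement with the factor 1 - e^0. *)
Lemma igF_y (b s : R) : 0 <= b -> 0 < s ->
  igF b s x @[x --> +oo] --> s^-1 * (1 - expR (2 * b * s)).
Proof.
rewrite le_eqVlt => /predU1P[<-|b0] s0.
  rewrite mulr0 mul0r expR0 subrr mulr0.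
  have ri : s / Num.sqrt x @[x --> +oo] --> (0 : R).
    apply/cvgr0Pnorm_le => e e0; near=> x.
    have xc : (s / e) ^+ 2 < x by near: x; apply: nbhs_pinfty_gt; exact: num_real.
    have se : 0 < s / e by rewrite divr_gt0.
    have x0 : 0 < x by rewrite (lt_trans _ xc) // exprn_gt0.
    have r0 : 0 < Num.sqrt x by rewrite sqrtr_gt0.
    have rc : s / e <= Num.sqrt x.
      by apply: le_sqrtr; exact: ltW.
    rewrite ger0_norm; last by rewrite divr_ge0 // ltW.
    by rewrite ler_pdivrMr // mulrC -ler_pdivrMr.
  have cPhi : {for (0 : R), continuous Phi}.
    apply: differentiable_continuous; apply/derivable1_diffP.
    by have [] := Phi_derive 0.
  rewrite [X in _ --> X](_ : _ = s^-1 * (Phi (- 0) - 1 * Phi 0)); last first.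
    by rewrite oppr0 mul1r subrr mulr0.
  rewrite /igF; under eq_fun do rewrite mulr0 !mul0r expR0 sub0r add0r.
  apply: cvgMr; apply: cvgB; last apply: cvgMr.
    by rewrite oppr0; apply: continuous_cvg => //; rewrite -oppr0; apply: cvgN.
  by apply: continuous_cvg.
apply: cvgMr; apply: cvgB; last first.
  rewrite -[X in _ --> X]mulr1; apply: cvgMr.
  by apply: cvg_comp Phi_y; apply: igF_arg_cvgy_pinfty.
apply: cvg_comp Phi_y.
by under eq_fun do rewrite -mulNr; apply: igF_arg_cvgy_pinfty.
Unshelve. all: by end_near. Qed.

Lemma igF_0 (b s : R) : 0 <= b -> 0 < s ->
  igF b s x @[x --> 0^'+] --> - (s^-1 * expR (2 * b * s)).
Proof.
move=> b0 s0; rewrite -mulrN -[X in s^-1 * X]sub0r -[X in 0 - X]mulr1.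
apply: cvgMr; apply: cvgB; last apply: cvgMr.
  by apply: cvg_comp Phi_Ny; apply: igF_arg_cvgNy.
by apply: cvg_comp Phi_y; apply: igF_arg_cvgy.
Qed.

Lemma igf_ge0 (b s x : R) : 0 <= igf b s x.
Proof. by rewrite /igf; case: ifP => // _; rewrite mulr_ge0 ?sqrtr_ge0 ?expR_ge0. Qed.

(** Square of e^(z/2) >= 1 + z/2. Quadratic decay is enough to beat x^(-3/2) at 0 and, in
    [cvg_natr_expR], the factor n. *)
Lemma expRN_le (z : R) : 0 < z -> expR (- z) <= 4 / z ^+ 2.
Proof.
move=> z0; rewrite expRN ler_pdivlMr ?exprn_gt0 // ler_pdivrMl ?expR_gt0 //.
have -> : expR z = expR (z / 2) ^+ 2 by rewrite -expRM_natl mulrC divfK.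
have := expR_ge1Dx (z / 2).
set e := expR _; have : 0 < z / 2 by rewrite divr_gt0.
nra.
Qed.

(** Continuity at the left endpoint, for the fundamental theorem of calculus on [[0, +oo[]. The
    exponent is of order 1 / x, so its exponential is O(x^2) and the product O(sqrt x). *)
Lemma igf_cvg0 (b s : R) : 0 <= b -> 0 < s -> igf b s x @[x --> 0^'+] --> (0 : R).
Proof.
move=> b0 s0.
have p0 : 0 <= normal_peak 1 :> R by rewrite normal_peak_ge0.
apply: (squeeze_cvgr (f := cst 0)
  (h := fun x => normal_peak 1 * (256 / s ^+ 4) * Num.sqrt x)).
- near=> x.
  have x0 : 0 < x by near: x; exact: nbhs_right_gt.
  (* This makes b x <= s / 2, hence (s - b x)^4 >= s^4 / 16; the constant 256 below is 16 times
     16. *)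
  have x1 : x < s / (2 * b + 1).
    by near: x; apply: nbhs_right_lt; rewrite divr_gt0 // ltr_wpDl ?mulr_ge0.
  apply/andP; split; first exact: igf_ge0.
  rewrite /igf (leNgt x) x0 /= normal_peak_sqrt //.
  have r0 : 0 < Num.sqrt x by rewrite sqrtr_gt0.
  have h : s / 2 <= s - b * x.
    move: x1; rewrite ltr_pdivlMr ?ltr_wpDl ?mulr_ge0 //; lra.
  have sb : 0 < s - b * x by lra.
  have z0 : 0 < (b * x - s) ^+ 2 / (2 * x).
    apply: divr_gt0; last by rewrite mulr_gt0.
    by rewrite -sqrrN opprB exprn_gt0.
  have e2 : 4 / ((b * x - s) ^+ 2 / (2 * x)) ^+ 2 <= 256 * x ^+ 2 / s ^+ 4.
    have -> : 4 / ((b * x - s) ^+ 2 / (2 * x)) ^+ 2 = 16 * x ^+ 2 / (s - b * x) ^+ 4.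
      by field; rewrite -[b * x - s]opprB oppr_eq0 !gt_eqF.
    rewrite ler_pdivrMr ?exprn_gt0 //.
    have -> : 256 * x ^+ 2 / s ^+ 4 * (s - b * x) ^+ 4 = 16 * x ^+ 2 * ((s - b * x) / (s / 2))
      ^+ 4.
      by field; rewrite gt_eqF.
    apply: ler_peMr; first by rewrite mulr_ge0 // exprn_ge0 // ltW.
    by rewrite exprn_ege1 // ler_pdivlMr ?divr_gt0 // mul1r.
  have -> : normal_peak 1 * (256 / s ^+ 4) * Num.sqrt x =
      normal_peak 1 * (Num.sqrt x)^-1 ^+ 3 * (256 * x ^+ 2 / s ^+ 4).
    by rewrite -{3}[x]sqr_sqrtr ?ltW //; field; rewrite !gt_eqF.
  apply: ler_wpM2l; first by rewrite mulr_ge0 // exprn_ge0 // invr_ge0 ltW.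
  exact: le_trans (expRN_le z0) e2.
- exact: cvg_cst.
- rewrite -[X in _ --> X](mulr0 (normal_peak 1 * (256 / s ^+ 4))).
  apply: cvgMr; rewrite -[X in _ --> X]sqrtr0; apply: cvg_at_right_filter.
  exact: sqrt_continuous.
Unshelve. all: by end_near. Qed.

Lemma continuous_igf (b s x : R) : 0 < x -> {for x, continuous (igf b s)}.
Proof.
move=> x0.
have r0 : 0 < Num.sqrt x by rewrite sqrtr_gt0.
pose g (x : R) := normal_peak 1 * (Num.sqrt x)^-1 ^+ 3 * expR (- ((b * x - s) ^+ 2 / (2 * x))).
have gE (y : R) : 0 < y -> g y = igf b s y.
  by move=> y0; rewrite /igf (leNgt y) y0 /= normal_peak_sqrt.
have E : {near x, g =1 igf b s}.
  near=> y; apply: gE; near: y; exact: lt_nbhsr.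
rewrite /prop_for /continuous_at -gE //.
apply: cvg_trans (near_eq_cvg E) _.
have c1 : (Num.sqrt y)^-1 @[y --> x] --> (Num.sqrt x)^-1.
  by apply: cvgV; rewrite ?gt_eqF //; exact: sqrt_continuous.
have c2 : b * y - s @[y --> x] --> b * x - s.
  by apply: cvgB; [apply: cvgMr; exact: cvg_id|exact: cvg_cst].
apply: cvgM; first by apply: cvgMr; exact: (cvgM c1 (cvgM c1 c1)).
apply: continuous_cvg; first exact: continuous_expR.
apply: cvgN; apply: cvgM; first exact: (cvgM c2 c2).
apply: cvgV; first by rewrite gt_eqF // mulr_gt0.
by apply: cvgMr; exact: cvg_id.
Unshelve. all: by end_near. Qed.

Lemma integral_igf (b s : R) : 0 <= b -> 0 < s ->
  (\int[lebesgue_measure]_(x in `[0%R, +oo[) (igf b s x)%:E = (s^-1)%:E)%E.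
Proof.
move=> b0 s0.
(* [igF] extended to the left of 0 by its limit at 0+, so that F is continuous at 0 and F(+oo) -
   F(0) = 1 / s. *)
pose F (x : R) : R := if x <= 0 then - (s^-1 * expR (2 * b * s)) else igF b s x.
have FE (x : R) : 0 < x -> {near x, igF b s =1 F}.
  move=> x0; near=> y; rewrite /F [_ <= 0]leNgt ifN // negbK.
  by near: y; exact: lt_nbhsr.
have dF (x : R) : 0 < x -> is_derive x 1 F (igf b s x).
  move=> x0; exact: (near_eq_is_derive (FE x x0) (is_derive_igF b s0 x0)).
rewrite (@ge0_continuous_FTC2y _ (igf b s) F 0 (s^-1 * (1 - expR (2 * b * s)))).
- by rewrite /F lexx -EFinB; congr (_%:E); rewrite mulrBr mulr1 opprK subrK.
- by move=> x _; exact: igf_ge0.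
- apply/continuous_within_itvcyP; split.
    by move=> x; rewrite in_itv /= andbT; exact: continuous_igf.
  by rewrite /igf lexx; exact: igf_cvg0.
- apply: cvg_trans (igF_y b0 s0); apply: near_eq_cvg; near=> x.
  by rewrite /F [_ <= 0]leNgt ifN // negbK; near: x; exact: nbhs_pinfty_gt.
- by move=> x x0; have [] := dF x x0.
- rewrite {2}/F lexx; apply: cvg_trans (igF_0 b0 s0); apply: near_eq_cvg; near=> x.
  by rewrite /F [_ <= 0]leNgt ifN // negbK; near: x; exact: nbhs_right_gt.
- by move=> x; rewrite in_itv /= andbT => x0; rewrite derive1E; have [] := dF x x0.
Unshelve. all: by end_near. Qed.

End Phi.

(** * Exponential tilting of [igf] *)

Section igf_laws.
Variable R : realType.

(** Completion of the square: (a x - 1)^2 / (2 x) + (s^2 - 1) / (2 x) + (b^2 - a^2) x / 2 = (b x -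
    s)^2 / (2 x) + b s - a. The tilt in 1 / x will come from the potential at the eliminated vertex,
    the tilt in x from the conductances that its elimination creates. *)
Lemma igf_tilt (a b s x : R) :
  igf a 1 x * expR (- ((s ^+ 2 - 1) / (2 * x)) - (b ^+ 2 - a ^+ 2) * x / 2) =
  expR (a - b * s) * igf b s x.
Proof.
rewrite /igf; case: leP => [_|x0]; first by rewrite mul0r mulr0.
rewrite -[LHS]mulrA -expRD [RHS]mulrCA -expRD; congr (_ * expR _).
by field; rewrite gt_eqF.
Qed.

Lemma measurable_invr : measurable_fun setT (@GRing.inv R).
Proof.
have -> : @GRing.inv R = fun x => if x == 0 then 0 else x^-1.
  by apply/funext => x; case: eqVneq => // ->; rewrite invr0.
apply: measurable_fun_if => //=.
  exact: measurable_fun_eqr.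
rewrite setTI (_ : _ @^-1` _ = [set x | x != 0]); last first.
  by apply/seteqP; split => x /= => [->|/negbTE].
apply: open_continuous_measurable_fun; first exact: open_neq.
by move=> x /set_mem /= x0; exact: inv_continuous.
Qed.

(** Joint measurability matters because the parameter of the density sampled at each step is a
    function of the past. *)
Lemma measurable_igf2 :
  measurable_fun setT (fun z : R * R => igf z.1 1 z.2).
Proof.
rewrite /igf; apply: measurable_fun_ifT => //=.
  exact: measurable_fun_ler.
apply: measurable_funM.
  apply: measurableT_comp; first exact: continuous_measurable_fun (@sqrt_continuous R).
  apply: measurable_funM => //; apply: (measurableT_comp measurable_invr).
  by apply: measurable_funM => //; exact: measurable_funX.
apply: measurableT_comp => //; apply: measurableT_comp => //.
apply: measurable_funM.
  by apply: measurable_funX; apply: measurable_funB => //; exact: measurable_funM.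
by apply: (measurableT_comp measurable_invr); exact: measurable_funM.
Qed.

Lemma measurable_igf (b s : R) : measurable_fun setT (igf b s).
Proof.
rewrite /igf; apply: measurable_fun_ifT => //=.
  exact: measurable_fun_ler.
apply: measurable_funM.
  apply: measurableT_comp; first exact: continuous_measurable_fun (@sqrt_continuous R).
  apply: measurable_funM => //; apply: (measurableT_comp measurable_invr).
  by apply: measurable_funM => //; exact: measurable_funX.
apply: measurableT_comp => //; apply: measurableT_comp => //.
apply: measurable_funM.
  by apply: measurable_funX; apply: measurable_funB => //; exact: measurable_funM.
by apply: (measurableT_comp measurable_invr); exact: measurable_funM.
Qed.

Lemma integralT_igf (b s : R) : 0 <= b -> 0 < s ->
  (\int[lebesgue_measure]_x (igf b s x)%:E = (s^-1)%:E)%E.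
Proof.
move=> b0 s0; rewrite -(integral_igf b0 s0) [RHS]integral_mkcond.
apply: eq_integral => x _; rewrite patchE; case: ifPn => //.
by rewrite notin_setE /= in_itv /= andbT => /negP; rewrite -ltNge /igf => /ltW ->.
Qed.

Lemma integral_igf_tilt (a b s : R) : 0 <= b -> 0 < s ->
  (\int[lebesgue_measure]_x (igf a 1 x *
     expR (- ((s ^+ 2 - 1) / (2 * x)) - (b ^+ 2 - a ^+ 2) * x / 2))%:E =
   (expR (a - b * s) / s)%:E)%E.
Proof.
move=> b0 s0; under eq_integral do rewrite igf_tilt EFinM.
rewrite ge0_integralZl ?integralT_igf ?lee_fin ?expR_ge0 ?EFinM //.
- by apply/measurable_EFinP; exact: measurable_igf.
- by move=> x _; rewrite lee_fin igf_ge0.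
Qed.

End igf_laws.

(** * Probabilities given by a density *)

Section density.
Import HBNNSimple.
Local Open Scope ereal_scope.
Context d (T : measurableType d) (R : realType) (mu : {measure set T -> \bar R}).
Variable f : T -> R.
Hypotheses (f0 : forall x, (0 <= f x)%R) (mf : measurable_fun setT f)
  (f1 : \int[mu]_x (f x)%:E = 1).

Definition density_prob (A : set T) : \bar R := \int[mu]_(x in A) (f x)%:E.

Let mEf A : measurable_fun A (EFin \o f).
Proof. by apply/measurable_EFinP; exact: measurable_funTS. Qed.

Let density0 : density_prob set0 = 0.
Proof. by rewrite /density_prob integral_set0. Qed.

Let density_ge0 A : 0 <= density_prob A.
Proof. by apply: integral_ge0 => x _; rewrite lee_fin. Qed.

Let density_sigma_additive : semi_sigma_additive density_prob.
Proof.
move=> A mA tA mUA; rewrite /density_prob ge0_integral_bigcup //=.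
- by apply: is_cvg_ereal_nneg_natsum_cond => n _ _; exact: density_ge0.
- by move=> x _; rewrite lee_fin.
Qed.

HB.instance Definition _ := isMeasure.Build _ _ _
  density_prob density0 density_ge0 density_sigma_additive.

HB.instance Definition _ :=
  @Measure_isProbability.Build _ _ R density_prob f1.

(** Simple functions increase to g and both sides pass to the limit by monotone convergence; for an
    indicator the equality is the definition of [density_prob]. *)
Lemma integral_density (g : T -> \bar R) : (forall x, 0 <= g x) ->
  measurable_fun setT g ->
  \int[density_prob]_x g x = \int[mu]_x (g x * (f x)%:E).
Proof.
move=> g0 mg; pose h := nnsfun_approx measurableT mg.
have hg x : EFin (h n x) @[n --> \oo] --> g x.
  by apply: cvg_nnsfun_approx => //= y _; exact: g0.
have mh n : measurable_fun setT (EFin \o h n) by exact/measurable_EFinP.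
have ndh x : {homo (fun n => h n x) : m n / (m <= n)%N >-> (m <= n)%R}.
  by move=> m n mn; exact/lefP/nd_nnsfun_approx.
have lhs : \int[density_prob]_x (h n x)%:E @[n --> \oo] --> \int[density_prob]_x g x.
  rewrite (eq_integral (fun x => limn (fun n => (h n x)%:E))).
    apply: cvg_monotone_convergence => //= [n x _|x _ m n mn]; first by rewrite lee_fin.
    by rewrite lee_fin; exact: ndh.
  by move=> x _; apply/esym/cvg_lim => //; exact: hg.
have rhs : \int[mu]_x ((h n x)%:E * (f x)%:E) @[n --> \oo] -->
    \int[mu]_x (g x * (f x)%:E).
  rewrite (eq_integral (fun x => limn (fun n => (h n x)%:E * (f x)%:E))).
    apply: cvg_monotone_convergence => //= [n|n x _|x _ m n mn].
    - by apply: emeasurable_funM; [exact: mh|exact: mEf].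
    - by rewrite mule_ge0 // lee_fin.
    - by rewrite lee_wpmul2r ?lee_fin //; exact: ndh.
  by move=> x _; apply/esym/cvg_lim => //; apply: cvgeZr => //; exact: hg.
suff e n : \int[density_prob]_x (h n x)%:E = \int[mu]_x ((h n x)%:E * (f x)%:E).
  by rewrite -(cvg_lim _ lhs) // -(cvg_lim _ rhs) //; under eq_fun do rewrite e.
have hE x : (h n x)%:E = \sum_(y \in range (h n)) (y * \1_(h n @^-1` [set y]) x)%:E.
  by rewrite fimfunE -fsumEFin.
have h0 y x : 0 <= (y * \1_(h n @^-1` [set y]) x)%:E by exact: nnfun_muleindic_ge0.
pose hy y x := (y * \1_(h n @^-1` [set y]) x)%:E.
transitivity (\int[density_prob]_x (\sum_(y \in range (h n)) hy y x)).
  by apply: eq_integral => x _; exact: hE.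
transitivity (\int[mu]_x (\sum_(y \in range (h n)) hy y x * (f x)%:E)); last first.
  by apply: eq_integral => x _; rewrite hE ge0_mule_fsuml.
have mhy y : measurable_fun setT (hy y).
  by apply/measurable_EFinP; exact: measurable_funM.
have mhyf y : measurable_fun setT (fun x => hy y x * (f x)%:E).
  by apply: emeasurable_funM; [exact: mhy|exact: mEf].
rewrite (ge0_integral_fsum _ _ mhy) //.
transitivity (\sum_(y \in range (h n)) \int[mu]_x (hy y x * (f x)%:E)); last first.
  apply/esym/ge0_integral_fsum => //.
  by move=> y x _; rewrite mule_ge0 // ?lee_fin //; exact: h0.
apply: eq_fsbigr => y /set_mem [x _ <-].
have r0 : 0 <= (h n x)%:E by rewrite lee_fin.
rewrite /hy; under eq_integral do rewrite EFinM.
under [RHS]eq_integral do rewrite EFinM -muleA.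
pose I := h n @^-1` [set h n x].
have mS : measurable I by exact: measurable_sfunP.
have mI : measurable_fun setT (EFin \o (\1_I : T -> R)).
  by apply/measurable_EFinP; exact: measurable_indic.
rewrite (ge0_integralZl _ measurableT mI _ r0); last by move=> z _; rewrite lee_fin.
rewrite ge0_integralZl //.
- rewrite integral_indic // setIT; congr (_ * _).
  transitivity (\int[mu]_(z in I) (f z)%:E) => //.
  rewrite [LHS]integral_mkcond; apply: eq_integral => z _.
  by rewrite epatch_indic muleC.
- by apply: emeasurable_funM; [exact: mI|exact: mEf].
- by move=> z _; rewrite mule_ge0 // lee_fin.
- by move=> y x _; exact: h0.
Qed.

Lemma exists_density : exists nu : probability T R,
  (forall A, measurable A -> nu A = \int[mu]_(x in A) (f x)%:E) /\
  forall g : T -> \bar R, (forall x, 0 <= g x) -> measurable_fun setT g ->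
    \int[nu]_x g x = \int[mu]_x (g x * (f x)%:E).
Proof.
by exists density_prob; split => // g; exact: integral_density.
Qed.
End density.

(** * Boxes and Borel sets of R^I *)

Section boxes.
Variables (R : realType).

(** A list of constraints, repetitions allowed, so that concatenation is intersection and boxes form
    a pi-system. *)
Definition box (I : Type) (s : seq (I * R)) : set (I -> R) :=
  [set f | all (fun p => p.2 < f p.1) s].

Lemma box_cat (I : Type) (s t : seq (I * R)) : box (s ++ t) = box s `&` box t.
Proof.
by apply/seteqP; split => f /=; rewrite /box /= all_cat => /andP.
Qed.

Definition rbox (I : Type) (s : seq (I * (rat * rat))) : set (I -> R) :=
  [set f | all (fun p => ratr p.2.1 < f p.1 < ratr p.2.2) s].

Lemma open_coord (I : eqType) (i : I) (A : set R) : open A ->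
  open ([set f | A (f i)] : set {ptws I -> R}).
Proof.
move=> oA; apply: ((@continuousP {ptws I -> R} R (fun f => f i)).1 _ _ oA).
exact: (@proj_continuous I (fun=> R) i).
Qed.

Lemma open_box (I : eqType) (s : seq (I * R)) : open (box s : set {ptws I -> R}).
Proof.
elim: s => [|p s IHs].
  by rewrite (_ : box _ = setT) //; [exact: openT|apply/seteqP; split].
rewrite -cat1s box_cat; apply: openI => //.
rewrite (_ : box _ = [set f | `]p.2, +oo[%classic (f p.1)]); last first.
  by apply/seteqP; split => f; rewrite /box /= in_itv /= !andbT.
by apply: open_coord; exact: interval_open.
Qed.

(** A basic neighbourhood of f is a finite intersection of preimages of open sets by coordinates.
    Each coordinate of f is enclosed between two rationals, and the lists of bounds are
    concatenated. *)
Lemma rbox_nbhs (I : choiceType) (O : set {ptws I -> R}) (f : {ptws I -> R}) :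
  open O -> O f -> exists s, rbox s f /\ rbox s `<=` O.
Proof.
move=> oO Of; have : nbhs f O by exact: open_nbhs_nbhs.
rewrite nbhsE => -[_ [[B sB <-] [C BC Cf] sUB]].
suff [s [sf sC]] : exists s, rbox s f /\ rbox s `<=` C.
  by exists s; split => // g /sC Cg; apply: sUB; exists C.
have /sB [D sD IDeC] := BC.
have Df E : E \in D -> E f by move=> ED; move: Cf; rewrite -IDeC => /(_ E ED).
have key (E : set {ptws I -> R}) : E \in D -> exists s, rbox s f /\ rbox s `<=` E.
  move=> ED; have := sD _ ED; rewrite inE => -[i _].
  case=> A oA AE; have := Df _ ED; rewrite -AE /= => Afi.
  have : nbhs (f i) A by exact: open_nbhs_nbhs.
  move=> /nbhs_ballP[e /= e0 eA].
  have fl : f i - e < f i by rewrite ltrBlDr ltrDl.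
  have fr : f i < f i + e by rewrite ltrDl.
  have [q] := rat_in_itvoo fl.
  rewrite in_itv /= => /andP[q1 q2].
  have [r] := rat_in_itvoo fr.
  rewrite in_itv /= => /andP[r1 r2].
  exists [:: (i, (q, r))]; split; first by rewrite /rbox /= q2 r1.
  move=> g; rewrite /rbox /= andbT => /andP[g1 g2].
  by apply: eA; rewrite /ball /= ltr_distlC; apply/andP; split; lra.
have : exists s, rbox s f /\ rbox s `<=` [set g | forall E, E \in enum_fset D -> E g].
  have : forall E, E \in enum_fset D -> E \in D by [].
  elim: (enum_fset D) => [_|E l IH lD]; first by exists [::]; split.
  have [|s [sf sl]] := IH; first by move=> E' E'l; apply: lD; rewrite inE E'l orbT.
  have [|t [tf tE]] := key E; first by apply: lD; rewrite inE eqxx.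
  exists (s ++ t); split; first by rewrite /rbox /= all_cat; apply/andP; split.
  move=> g; rewrite /rbox /= all_cat => /andP[sg tg] E'.
  by rewrite inE => /orP[/eqP->|E'l]; [exact: tE|exact: sl].
by move=> [s [sf sl]]; exists s; split => // g /sl /= Dg; rewrite -IDeC => E ED; exact: Dg.
Qed.

(* A countable index set makes the Borel sigma-algebra of the pointwise topology
   generated by the half-spaces [a < x i], as boxes with rational bounds form a
   countable base. *)
Lemma borel_box (I : countType) (S : pointedType) (tau : set (set S))
  (v : S -> {ptws I -> R}) :
  (forall O, tau O <-> exists2 O', open O' & v @^-1` O' = O) ->
  @measurable _ (g_sigma_algebraType tau) =
    <<s [set v @^-1` box s | s in [set: seq (I * R)]] >>.
Proof.
move=> openS; set G := [set _ | _ in _].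
apply/seteqP; split; last first.
  apply: smallest_sub; first exact: smallest_sigma_algebra.
  move=> _ [s _ <-]; apply: sub_sigma_algebra; apply/openS.
  by exists (box s) => //; exact: open_box.
apply: smallest_sub; first exact: smallest_sigma_algebra.
move=> A /openS [B oB] <-.
have -> : B = \bigcup_(s in [set s | rbox s `<=` B]) rbox s :> set (I -> R).
  apply/seteqP; split => [f Bf|f [s /= sB]]; last exact: sB.
  by have [s [sf sB]] := rbox_nbhs oB Bf; exists s.
rewrite preimage_bigcup bigcup_mkcond.
apply: (@countable_bigcupT_measurable _ (g_sigma_algebraType G)); first exact: countableP.
move=> s; case: ifP => // _.
have coord (i : I) : measurable_fun setT ((fun x => v x i) : g_sigma_algebraType G -> R).
  apply: (measurability _ (RGenOInfty.measurableE R)) => //.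
  move=> _ [_ [x ->] <-]; rewrite setTI; apply: sub_sigma_algebra.
  exists [:: (i, x)] => //; apply/seteqP; split => f; rewrite /box /= in_itv /= !andbT //.
elim: s => [|p s IHs].
  by rewrite (_ : rbox _ = setT) ?preimage_setT //; apply/seteqP; split.
rewrite (_ : _ @^-1` _ = [set x | `]ratr p.2.1, ratr p.2.2[%classic (v x p.1)] `&` (v @^-1`
  rbox s)).
  apply: measurableI => //.
  by rewrite -[X in measurable X]setTI; apply: coord => //; exact: measurable_itv.
by apply/seteqP; split => f; rewrite /rbox /= in_itv /= => /andP.
Qed.

(** * Topologies pulled back from R^I, where [v] will be the identity or the inclusion of the
    domain *)

Section induced.
Variables (I : countType) (S : pointedType) (tau : set (set S))
  (v : S -> {ptws I -> R}).
Hypothesis openS :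
  forall O, tau O <-> exists2 O', open O' & v @^-1` O' = O.

Lemma measurable_coord (i : I) :
  measurable_fun setT ((fun x => v x i) : g_sigma_algebraType tau -> R).
Proof.
apply: (measurability _ (RGenOInfty.measurableE R)) => //.
move=> _ [_ [x ->] <-]; rewrite setTI; apply: sub_sigma_algebra.
apply/openS; exists [set f | `]x, +oo[%classic (f i)] => //.
by apply: open_coord; exact: interval_open.
Qed.

Lemma measurable_box (s : seq (I * R)) :
  measurable (v @^-1` box s : set (g_sigma_algebraType tau)).
Proof.
by apply: sub_sigma_algebra; apply/openS; exists (box s) => //; exact: open_box.
Qed.

Lemma measurable_to_borel d (T : measurableType d) (f : T -> g_sigma_algebraType tau) :
  (forall i, measurable_fun setT (fun x => v (f x) i)) -> measurable_fun setT f.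
Proof.
move=> mf; apply: (measurability _ (borel_box openS)).
move=> _ [_ [s _ <-] <-]; rewrite setTI.
elim: s => [|p s IHs].
  by rewrite (_ : _ @^-1` _ = setT) //; apply/seteqP; split.
rewrite (_ : _ @^-1` _ = (fun x => v (f x) p.1) @^-1` `]p.2, +oo[%classic `&`
   f @^-1` (v @^-1` box s)).
  apply: measurableI => //.
  by rewrite -[X in measurable X]setTI; apply: mf => //; exact: measurable_itv.
by apply/seteqP; split => x; rewrite /box /= in_itv /= andbT => /andP.
Qed.

Lemma borel_measure_unique (m1 m2 : {finite_measure set (g_sigma_algebraType tau) -> \bar R}) :
  (forall s, m1 (v @^-1` box s) = m2 (v @^-1` box s)) ->
  forall A, measurable A -> m1 A = m2 A.
Proof.
move=> m12; apply: (measure_unique _ (fun=> setT) (borel_box openS)).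
- move=> _ _ [s _ <-] [t _ <-]; exists (s ++ t) => //.
  by rewrite box_cat preimage_setI.
- by move=> _; exists [::] => //; apply/seteqP; split.
- by apply/seteqP; split => // x _; exists 0%N.
- by move=> _ [s _ <-]; exact: m12.
- by move=> _; rewrite -ge0_fin_numE // fin_num_measure.
Qed.

End induced.

Lemma open_ptws_id (I : Type) (O : set {ptws I -> R}) :
  open O <-> exists2 O', open O' & id @^-1` O' = O.
Proof. by split => [oO|[B oB <-]] //; exists O. Qed.

Lemma open_DV (V : choiceType) (G : graph V) (W : {fset V} -> R) (O : set (DV G W)) :
  open O <-> exists2 O', open O' & (fun b : DV G W => val b : {ptws V -> R}) @^-1` O' = O.
Proof. by []. Qed.

End boxes.

(** * Enumeration of the vertices; images of laws *)

Section enumeration.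
Variables (V : choiceType) (iota : V -> nat) (iota_inj : injective iota).

Definition vertex_at (n : nat) : option V :=
  if pselect (exists v, iota v = n) is left h then Some (projT1 (cid h)) else None.

Lemma vertex_atK : pcancel iota vertex_at.
Proof.
move=> v; rewrite /vertex_at; case: pselect => [h|[]]; last by exists v.
by case: cid => w /= /iota_inj ->.
Qed.

Lemma vertex_at_Some n v : vertex_at n = Some v -> iota v = n.
Proof. by rewrite /vertex_at; case: pselect => // h [<-]; case: cid. Qed.

(** V is given as a [choiceType]; the injection provided by [graph_countable] becomes a structure
    here, so that the results on boxes apply to V and to its subsets. *)
Definition vertex_countType : countType := HB.pack V (Choice_isCountable.Build V vertex_atK).

End enumeration.

Lemma exists_pushforward d d' (T : measurableType d) (T' : measurableType d')
    (R : realType) (P : probability T R) (f : T -> T') :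
  measurable_fun setT f ->
  exists Q : probability T' R,
    (forall A, measurable A -> Q A = P (f @^-1` A)) /\
    forall g : T' -> \bar R, (forall x, 0 <= g x)%E -> measurable_fun setT g ->
      (\int[Q]_x g x = \int[P]_x g (f x))%E.
Proof.
move=> mf; pose fm : {mfun T >-> T'} := HB.pack f (isMeasurableFun.Build _ _ _ _ f mf).
exists (distribution P fm); split => // g g0 mg.
by rewrite (ge0_integral_pushforward mf).
Qed.

(** The pair (x, y) is given the density k for the product measure; by Fubini its total mass is the
    mu-integral of the masses of the kernels, all equal to 1. The new law is the image by u. *)
Lemma exists_kernel_pushforward d1 d2 d3 (T1 : measurableType d1)
    (T2 : measurableType d2) (T3 : measurableType d3) (R : realType)
    (mu : probability T1 R) (nu : {sigma_finite_measure set T2 -> \bar R})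
    (k : T1 * T2 -> R) (u : T1 * T2 -> T3) :
  measurable_fun setT k -> measurable_fun setT u -> (forall z, 0 <= k z) ->
  (forall x, \int[nu]_y (k (x, y))%:E = 1)%E ->
  exists mu' : probability T3 R, forall f : T3 -> \bar R,
    (forall x, 0 <= f x)%E -> measurable_fun setT f ->
    (\int[mu']_x f x = \int[mu]_x \int[nu]_y ((k (x, y))%:E * f (u (x, y))))%E.
Proof.
move=> mk mu0 k0 k1.
have mkE : measurable_fun setT (EFin \o k) by exact/measurable_EFinP.
have kT : (\int[mu \x nu]_z (k z)%:E = 1)%E.
  rewrite (fubini_tonelli1 _ mkE); last by move=> z; rewrite lee_fin.
  rewrite /fubini_F /=; under eq_integral do rewrite k1.
  by rewrite integral_cst // mul1e; exact: probability_setT.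
have [P [_ PE]] := exists_density k0 mk kT.
have [mu' [_ mu'E]] := exists_pushforward P mu0.
exists mu' => f f0 mf; rewrite mu'E // PE //; last exact: measurableT_comp mu0.
rewrite fubini_tonelli1 /=; last 2 first.
- by apply: emeasurable_funM => //; exact: measurableT_comp mu0.
- by move=> z; rewrite mule_ge0 // lee_fin.
by apply: eq_integral => x _; apply: eq_integral => t _; rewrite muleC.
Qed.

(** With [U] = Prop, this says that a set of sequences is determined by the first n coordinates. *)
Definition depends_on (A U : Type) n (f : (nat -> A) -> U) :=
  forall x y, (forall i, (i < n)%N -> x i = y i) -> f x = f y.

(** * Sequential sampling *)

Section process.
Variable R : realType.
Local Notation S := {ptws nat -> R}.
Local Notation T := (borel S).

Definition update (x : nat -> R) n (t : R) : nat -> R := fun i => if i == n then t else x i.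

Lemma measurable_nat_coord i : measurable_fun setT (fun x : T => x i).
Proof. exact: (measurable_coord (@open_ptws_id R nat) i).  Qed.

Lemma measurable_update n : measurable_fun setT ((fun z => update z.1 n z.2) : T * R -> T).
Proof.
apply: (measurable_to_borel (@open_ptws_id R nat)) => i /=; rewrite /update.
case: (eqVneq i n) => _; first exact: measurable_snd.
apply: (measurableT_comp (measurable_nat_coord i)).
exact: measurable_fst.
Qed.

Lemma exists_step (mu : probability T R) (a : T -> R) n :
  measurable_fun setT a -> (forall x, 0 <= a x) ->
  exists mu' : probability T R, forall f : T -> \bar R,
    (forall x, 0 <= f x)%E -> measurable_fun setT f ->
    (\int[mu']_x f x = \int[mu]_x \int[lebesgue_measure]_t
       ((igf (a x) 1 t)%:E * f (update x n t)))%E.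
Proof.
move=> ma a0; pose k (z : T * R) := igf (a z.1) 1 z.2.
have mk : measurable_fun setT k.
  have mp : measurable_fun setT (fun z : T * R => (a z.1, z.2)).
    apply: measurable_fun_pair; last exact: measurable_snd.
    by apply: (measurableT_comp ma); exact: measurable_fst.
  exact: (measurableT_comp (@measurable_igf2 R) mp).
have k0 z : 0 <= k z by exact: igf_ge0.
apply: (exists_kernel_pushforward mu (nu := @lebesgue_measure R) mk (measurable_update n) k0).
by move=> x; rewrite /k /= integralT_igf ?invr1.
Qed.

Variable a : nat -> T -> R.
Hypotheses (ma : forall n, measurable_fun setT (a n)) (a0 : forall n x, 0 <= a n x).

Definition step n (mu : probability T R) : probability T R :=
  projT1 (cid (exists_step mu n (ma n) (a0 n))).

Fixpoint law n : probability T R :=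
  if n is n'.+1 then step n' (law n') else \d_(cst 0 : T).

Lemma lawS n (f : T -> \bar R) :
  (forall x, 0 <= f x)%E -> measurable_fun setT f ->
    (\int[law n.+1]_x f x = \int[law n]_x \int[lebesgue_measure]_t
       ((igf (a n x) 1 t)%:E * f (update x n t)))%E.
Proof. by rewrite /= /step; case: cid => mu' /= h; exact: h. Qed.

(** Steps n to m - 1 modify only coordinates that f ignores, and each kernel has mass 1. *)
Lemma law_consistent n m (f : T -> \bar R) : (n <= m)%N -> depends_on n f ->
  (forall x, 0 <= f x)%E -> measurable_fun setT f ->
  (\int[law m]_x f x = \int[law n]_x f x)%E.
Proof.
move=> nm df f0 mf; elim: m nm => [|m IH]; first by rewrite leqn0 => /eqP->.
rewrite leq_eqVlt => /predU1P[->//|]; rewrite ltnS => nm.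
rewrite lawS // -IH //; apply: eq_integral => x _.
under eq_integral => t _.
  rewrite (df _ x); last by move=> i im; rewrite /update ltn_eqF // (leq_trans im).
  over.
rewrite ge0_integralZr ?integralT_igf ?invr1 ?mul1e //.
- by apply/measurable_EFinP; exact: measurable_igf.
- by move=> t _; rewrite lee_fin igf_ge0.
Qed.

End process.

(** * Vertex elimination and the Laplace martingale *)

Section reduction.
Variable R : realType.
Variables (w : nat -> nat -> R) (B : nat -> nat).
Hypotheses (w_sym : forall i j, w i j = w j i) (w_ge0 : forall i j, 0 <= w i j)
  (w_bound : forall n i j, (i <= n)%N -> (B n <= j)%N -> w i j = 0).

(* The coordinates of the process are almost surely positive; the junk value 1
   makes the identities below hold everywhere. *)
Definition pos (t : R) : R := if 0 < t then t else 1.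

Lemma pos_gt0 t : 0 < pos t.
Proof. by rewrite /pos; case: ifP. Qed.

(* Conductances left after eliminating the vertices 0, ..., n - 1 (Schur
   complement), where [pos (x m)] is the Green function of vertex m at the time
   of its elimination. *)
Fixpoint reduced (x : nat -> R) n i j : R := if n is m.+1
  then reduced x m i j + reduced x m m i * reduced x m m j * pos (x m) else w i j.

Lemma reduced_dep n i j : depends_on n (fun x => reduced x n i j).
Proof.
elim: n i j => [//|n IH] i j x y xy /=; rewrite xy //.
by rewrite !(IH _ _ x y) // => k kn; apply: xy; rewrite (ltn_trans kn).
Qed.

Lemma reduced_sym x n i j : reduced x n i j = reduced x n j i.
Proof. by elim: n i j => [//|n IH] i j /=;
  rewrite (IH i j) [in LHS](mulrC (reduced _ _ _ i)). Qed.

Lemma reduced_ge0 x n i j : 0 <= reduced x n i j.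
Proof.
by elim: n i j => [//|n IH] i j /=; rewrite addr_ge0 // !mulr_ge0 // ltW // pos_gt0.
Qed.

(** A link created by elimination joins two neighbours, at that time, of some eliminated m < N, and
    such an m has no link from B N on: the original bound survives. *)
Lemma reduced_bound x N n i j :
  (n <= N)%N -> (i <= N)%N -> (B N <= j)%N -> reduced x n i j = 0.
Proof.
elim: n i j => [|n IH] i j nN iN Bj /=; first exact: w_bound iN Bj.
by rewrite !(IH _ j) ?(ltnW nN) // mulr0 mul0r addr0.
Qed.

(** By [reduced_bound] the cut at [B n] loses nothing. The rate is 0 at the last vertex of a finite
    graph, whence the case b = 0 of [igf]. *)
Definition exit_rate n (x : nat -> R) : R := \sum_(n.+1 <= j < B n) reduced x n n j.

Lemma exit_rateE n x M : (B n <= M)%N -> (n < M)%N ->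
  exit_rate n x = \sum_(n.+1 <= j < M) reduced x n n j.
Proof.
move=> BM nM; rewrite /exit_rate; have [nB|Bn] := leqP n.+1 (B n).
  rewrite [RHS](big_cat_nat nB BM) /= [X in _ + X]big1_seq ?addr0 // => j.
  by rewrite mem_index_iota => /andP[_ /andP[Bj _]]; apply: reduced_bound Bj.
rewrite big_geq 1?ltnW // big1_seq // => j.
rewrite mem_index_iota => /andP[_ /andP[nj _]].
by apply: (@reduced_bound _ n) => //; rewrite (leq_trans _ (ltnW nj)) // -ltnS.
Qed.

Lemma exit_rate_ge0 n x : 0 <= exit_rate n x.
Proof. by apply: sumr_ge0 => j _; exact: reduced_ge0. Qed.

(** Solution of the pivot equation 2 beta_n - [reduced x n n n] = 1 / x_n, where the diagonal term
    collects the self-loops created by earlier eliminations. *)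
Definition beta (x : nat -> R) n : R := (2 * pos (x n))^-1 + reduced x n n n / 2.

Lemma beta_dep n i : (i < n)%N -> depends_on n (fun x => beta x i).
Proof.
move=> ni x y xy; rewrite /beta xy // (@reduced_dep i i i x y) // => k ki.
by apply: xy; exact: ltn_trans ni.
Qed.

Section sums.
Variable M : nat.

Lemma sum2_split k (F : nat -> nat -> R) : (k < M)%N -> (forall i j, F i j = F j i) ->
  \sum_(k <= i < M) \sum_(k <= j < M) F i j =
  F k k + 2 * (\sum_(k.+1 <= j < M) F k j) +
  \sum_(k.+1 <= i < M) \sum_(k.+1 <= j < M) F i j.
Proof.
move=> kM FC; rewrite big_ltn //.
under [X in _ + X]eq_bigr => i _ do rewrite big_ltn //.
rewrite big_split /= big_ltn //.
under [X in _ + (X + _)]eq_bigr => i _ do rewrite FC.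
ring.
Qed.

Lemma sum2_sqr k (c d : nat -> R) :
  \sum_(k <= i < M) \sum_(k <= j < M) (c i * c j * (d i * d j)) =
  (\sum_(k <= i < M) c i * d i) ^+ 2.
Proof.
rewrite expr2 mulr_suml; apply: eq_bigr => i _; rewrite mulr_sumr.
by apply: eq_bigr => j _; ring.
Qed.

(** Quadratic form of the Schur complement of H_beta after elimination of the vertices before k,
    restricted to the vertices before M. *)
Definition schur_form (x y : nat -> R) k : R :=
  \sum_(k <= i < M) \sum_(k <= j < M)
    y i * (- reduced x k i j + (2 * beta x i) *+ (i == j)) * y j.

(** One step of the LDL^T decomposition: complete the square in y_k, whose coefficient is the pivot.
    What the square takes from the remaining terms is the rank-one update of [reduced]. *)
Lemma schur_formS x y k : (k < M)%N ->
  schur_form x y k =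
  (pos (x k))^-1 * (y k - pos (x k) * \sum_(k.+1 <= j < M) reduced x k k j * y j) ^+ 2
  + schur_form x y k.+1.
Proof.
move=> kM; rewrite {1}/schur_form sum2_split //; last first.
  move=> i j; rewrite (reduced_sym x k i j) eq_sym.
  by case: eqP => [->|_]; rewrite ?mulr0n; ring.
set S := \sum_(k.+1 <= j < M) _ * y j.
have -> : \sum_(k.+1 <= j < M) y k * (- reduced x k k j + (2 * beta x k) *+ (k == j)) * y j
    = - (y k * S).
  rewrite mulr_sumr -sumrN; apply: eq_big_nat => j /andP[kj _].
  by rewrite ltn_eqF // mulr0n; ring.
have -> : schur_form x y k.+1 =
    \sum_(k.+1 <= i < M) \sum_(k.+1 <= j < M)
      y i * (- reduced x k i j + (2 * beta x i) *+ (i == j)) * y j - pos (x k) * S ^+ 2.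
  rewrite -sum2_sqr mulr_sumr -sumrB; apply: eq_bigr => i _.
  rewrite mulr_sumr -sumrB; apply: eq_bigr => j _ /=.
  by ring.
rewrite eqxx mulr1n {1}/beta.
have := pos_gt0 (x k); set p := pos (x k) => p0.
by field; rewrite gt_eqF.
Qed.

Lemma schur_form_ge0 x y k : 0 <= schur_form x y k.
Proof.
have [d] := ubnP (M - k); elim: d k => // d IH k dk.
have [kM|Mk] := ltnP k M; last by rewrite /schur_form big_geq.
rewrite schur_formS // addr_ge0 //; last by apply: IH; rewrite subnS -ltnS prednK ?subn_gt0.
by rewrite mulr_ge0 ?sqr_ge0 // invr_ge0 ltW // pos_gt0.
Qed.

(** Either some later y_j is nonzero and induction applies, or the sum inside the square vanishes
    and y_k alone makes the square positive. *)
Lemma schur_form_gt0 x y k : (exists2 i, (k <= i < M)%N & y i != 0) -> 0 < schur_form x y k.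
Proof.
have [d] := ubnP (M - k); elim: d k => // d IH k dk [i /andP[ki iM] yi].
have kM := leq_ltn_trans ki iM.
have dk1 : (M - k.+1 < d)%N by rewrite subnS -ltnS prednK ?subn_gt0.
have p0 : 0 < (pos (x k))^-1 by rewrite invr_gt0 pos_gt0.
rewrite schur_formS //.
have [[j kj yj]|y0] := pselect (exists2 j, (k.+1 <= j < M)%N & y j != 0).
  apply: ltr_wpDl; first by rewrite mulr_ge0 ?sqr_ge0 // ltW.
  by apply: IH => //; exists j.
have {}y0 j : (k.+1 <= j < M)%N -> y j = 0.
  by move=> kj; apply/eqP/negP => /negP yj; apply: y0; exists j.
have ik : i = k.
  by apply/eqP; rewrite eqn_leq ki leqNgt andbT; apply/negP => ik; rewrite y0 ?ik ?eqxx // in yi.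
rewrite ltr_pwDl ?schur_form_ge0 // mulr_gt0 // big1_seq.
  by rewrite mulr0 subr0 exprn_even_gt0 //= -ik.
by move=> j /andP[_]; rewrite mem_index_iota => /y0 ->; rewrite mulr0.
Qed.

End sums.
Local Notation T := (borel {ptws nat -> R}).

Lemma measurable_pos n : measurable_fun setT (fun x : T => pos (x n)).
Proof.
have m := @measurable_nat_coord R n.
by apply: measurable_fun_ifT => //; exact: measurable_fun_ltr.
Qed.

Lemma measurable_reduced n i j : measurable_fun setT (fun x : T => reduced x n i j).
Proof.
elim: n i j => [|n IH] i j /=; first exact: measurable_cst.
apply: measurable_funD => //; apply: measurable_funM; last exact: measurable_pos.
exact: measurable_funM.
Qed.

Lemma measurable_exit_rate n : measurable_fun setT (exit_rate n : T -> R).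
Proof. by apply: measurable_sum => j; exact: measurable_reduced. Qed.

Lemma measurable_beta n : measurable_fun setT (fun x : T => beta x n).
Proof.
apply: measurable_funD; last by apply: measurable_funM => //; exact: measurable_reduced.
apply: (measurableT_comp (@measurable_invr R)); apply: measurable_funM => //.
exact: measurable_pos.
Qed.

Section laplace.
Variables (s : nat -> R) (N M : nat).
Hypotheses (s_gt0 : forall i, 0 < s i) (s1 : forall i, (N <= i)%N -> s i = 1)
  (NM : (N <= M)%N) (BM : forall n, (n < N)%N -> (B n <= M)%N).

(** Twice the remaining Laplace exponent, the sum being over ordered pairs. *)
Definition coupling k (x : nat -> R) : R :=
  \sum_(k <= i < M) \sum_(k <= j < M) reduced x k i j * (s i * s j - 1).

(* The Laplace transform of beta conditionally on the first k coordinates. *)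
Definition partial_laplace k (x : nat -> R) : R :=
  expR (- \sum_(0 <= i < k) (s i ^+ 2 - 1) * beta x i) *
  (\prod_(k <= i < N) s i)^-1 * expR (- (coupling k x / 2)).

(** With r_j = [reduced x k k j], the rank-one term adds t times the double sum of r_i r_j (s_i s_j
    - 1), a difference of two squares equal to b^2 - a^2, where a is the exit rate. The other
    corrections remove row and column k. *)
Lemma coupling_update k x t : (k < N)%N -> 0 < t ->
  let b := \sum_(k.+1 <= j < M) reduced x k k j * s j in
  coupling k.+1 (update x k t) =
  coupling k x - reduced x k k k * (s k ^+ 2 - 1) - 2 * (s k * b - exit_rate k x) +
  (b ^+ 2 - exit_rate k x ^+ 2) * t.
Proof.
move=> kN t0 b; have kM : (k < M)%N by exact: leq_trans NM.
have cE := @sum2_split M k (fun i j => reduced x k i j * (s i * s j - 1)) kM.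
rewrite (@exit_rateE k x M) ?BM // {2}/coupling cE; last first.
  by move=> i j; rewrite reduced_sym [s i * _]mulrC.
rewrite /coupling.
have redE i j : reduced (update x k t) k i j = reduced x k i j.
  by apply: reduced_dep => m mk; rewrite /update ltn_eqF.
set D := \sum_(k.+1 <= i < M) \sum_(k.+1 <= j < M) (reduced x k i j * _).
have -> : \sum_(k.+1 <= j < M) reduced x k k j * (s k * s j - 1) =
    s k * b - \sum_(k.+1 <= j < M) reduced x k k j.
  by rewrite mulr_sumr -sumrB; apply: eq_bigr => j _; ring.
transitivity (D + t * (b ^+ 2 - (\sum_(k.+1 <= j < M) reduced x k k j) ^+ 2)); last by ring.
have -> : \sum_(k.+1 <= j < M) reduced x k k j = \sum_(k.+1 <= j < M) reduced x k k j * 1.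
  by apply: eq_bigr => j _; rewrite mulr1.
rewrite -!sum2_sqr -sumrB mulr_sumr -big_split; apply: eq_bigr => i _ /=.
rewrite -sumrB mulr_sumr -big_split; apply: eq_bigr => j _ /=.
by rewrite !redE /update eqxx /pos t0; ring.
Qed.

(** Martingale property. By [coupling_update] the integrand is a constant C times the tilted density
    of [integral_igf_tilt]: the self-loop part of beta_k cancels the diagonal term of the coupling.
    The integral e^(a - b s_k) / s_k then cancels the extra exponential in C and supplies the
    missing 1 / s_k. *)
Lemma partial_laplace_step k x : (k < N)%N ->
  (\int[lebesgue_measure]_t ((igf (exit_rate k x) 1 t)%:E *
     (partial_laplace k.+1 (update x k t))%:E) = (partial_laplace k x)%:E)%E.
Proof.
move=> kN; set a := exit_rate k x.
pose b := \sum_(k.+1 <= j < M) reduced x k k j * s j.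
have b0 : 0 <= b by apply: sumr_ge0 => j _; rewrite mulr_ge0 ?reduced_ge0 // ltW.
pose C := expR (- \sum_(0 <= i < k) (s i ^+ 2 - 1) * beta x i) *
  (\prod_(k.+1 <= i < N) s i)^-1 *
  expR (- (coupling k x / 2) + (s k * b - a)).
have E t : igf a 1 t * partial_laplace k.+1 (update x k t) =
   C * (igf a 1 t * expR (- ((s k ^+ 2 - 1) / (2 * t)) - (b ^+ 2 - a ^+ 2) * t / 2)).
  (* For t <= 0 both sides vanish with the density; for t > 0 [pos] is the identity. *)
  have [t0|t0] := leP t 0; first by rewrite /igf t0 !mul0r mulr0.
  rewrite [RHS]mulrCA; congr (_ * _).
  rewrite /partial_laplace /C coupling_update // big_nat_recr //=.
  rewrite [in LHS](eq_big_nat _ _ (F2 := fun i => (s i ^+ 2 - 1) * beta x i)); last first.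
    move=> i /andP[_ ik]; congr (_ * _).
    by apply: (@beta_dep k) => // m mk; rewrite /update ltn_eqF.
  have -> : beta (update x k t) k = (2 * t)^-1 + reduced x k k k / 2.
    rewrite /beta; congr ((2 * _)^-1 + _ / 2).
      by rewrite /update eqxx /pos t0.
    by apply: reduced_dep => m mk; rewrite /update ltn_eqF.
  rewrite -!mulrA [in LHS]mulrCA [in RHS]mulrCA -!expRD; congr (_ * expR _).
  rewrite -/a -/b; set S := \sum_(0 <= i < k) _.
  by field; rewrite gt_eqF.
under eq_integral do rewrite -EFinM E EFinM.
rewrite ge0_integralZl //.
- rewrite integral_igf_tilt // -EFinM /C /partial_laplace [in RHS]big_ltn // invfM.
  congr (_%:E); set P := \prod_(_ <= _ < _) _.
  have -> : expR (- (coupling k x / 2)) =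
     expR (- (coupling k x / 2) + (s k * b - a)) * expR (a - b * s k).
    by rewrite -expRD; congr expR; ring.
  by ring.
- apply/measurable_EFinP; apply: measurable_funM; first exact: measurable_igf.
  apply: measurableT_comp => //; apply: measurable_funB.
    apply: measurableT_comp => //; apply: measurable_funM => //.
    by apply: (measurableT_comp (@measurable_invr R)); exact: measurable_funM.
  by apply: measurable_funM => //; exact: measurable_funM.
- by move=> t _; rewrite lee_fin mulr_ge0 ?igf_ge0 ?expR_ge0.
- by rewrite lee_fin !mulr_ge0 ?expR_ge0 // invr_ge0 prodr_ge0 // => i _; exact: ltW.
Qed.

Definition reduction_law := law measurable_exit_rate exit_rate_ge0.

Lemma partial_laplace_ge0 k x : 0 <= partial_laplace k x.
Proof.
by rewrite !mulr_ge0 ?expR_ge0 // invr_ge0 prodr_ge0 // => i _; exact: ltW.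
Qed.

Lemma measurable_partial_laplace k : measurable_fun setT (partial_laplace k : T -> R).
Proof.
apply: measurable_funM; last first.
  apply: measurableT_comp => //; apply: measurableT_comp => //; apply: measurable_funM => //.
  apply: measurable_sum => i; apply: measurable_sum => j.
  by apply: measurable_funM => //; exact: measurable_reduced.
apply: measurable_funM => //; apply: measurableT_comp => //; apply: measurableT_comp => //.
by apply: measurable_sum => i; apply: measurable_funM => //; exact: measurable_beta.
Qed.

(** At time N the coupling only involves indices where s = 1, so it is 0 and the martingale is the
    integrand; at time 0 the law is a Dirac mass. *)
Lemma laplace_reduction_law :
  (\int[reduction_law N]_x (expR (- \sum_(0 <= i < N) (s i ^+ 2 - 1) * beta x i))%:E =
   ((\prod_(0 <= i < N) s i)^-1 *
     expR (- ((\sum_(0 <= i < M) \sum_(0 <= j < M) w i j * (s i * s j - 1)) / 2)))%:E)%E.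
Proof.
transitivity (\int[reduction_law N]_x (partial_laplace N x)%:E)%E.
  apply: eq_integral => x _; rewrite /partial_laplace big_geq // invr1 mulr1.
  rewrite (_ : coupling N x = 0) ?mul0r ?oppr0 ?expR0 ?mulr1 //.
  rewrite /coupling big1_seq // => i; rewrite mem_index_iota => /andP[_ /andP[Ni _]].
  rewrite big1_seq // => j; rewrite mem_index_iota => /andP[_ /andP[Nj _]].
  by rewrite !s1 // mulr1 subrr mulr0.
suff key k : (k <= N)%N -> (\int[reduction_law k]_x (partial_laplace k x)%:E =
    (partial_laplace 0 (cst 0))%:E)%E.
  rewrite key //; congr (_%:E); rewrite /partial_laplace (big_geq (leqnn 0)).
  by rewrite oppr0 expR0 mul1r.
elim: k => [_|k IH kN].
  rewrite integral_dirac //; last by apply/measurable_EFinP; exact: measurable_partial_laplace.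
  by rewrite diracT mul1e.
rewrite -IH ?(ltnW kN) // /reduction_law lawS //; last 2 first.
- by move=> x; rewrite lee_fin partial_laplace_ge0.
- by apply/measurable_EFinP; exact: measurable_partial_laplace.
by apply: eq_integral => x _; rewrite partial_laplace_step.
Qed.

End laplace.
End reduction.

(** * Realization of a consistent sequence of tests on [[0, 1[] *)

Section coding.
Context d (T : measurableType d) (R : realType).
Variables (P : nat -> probability T R) (E : nat -> set T).
Hypothesis mE : forall k, measurable (E k).

(* Words list the bits from the last to the first, so that [size v] is the index
   of the bit b in [b :: v]. *)
Fixpoint cell (w : seq bool) : set T :=
  if w is b :: v then cell v `&` (if b then E (size v) else ~` E (size v))
  else setT.

Hypothesis consistent : forall w, P (size w).+1 (cell w) = P (size w) (cell w).

Lemma measurable_cell w : measurable (cell w).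
Proof.
elim: w => [|[] v IH] /=; first exact: measurableT.
  exact: measurableI.
by apply: measurableI => //; exact: measurableC.
Qed.

Definition cell_prob w : R := fine (P (size w) (cell w)).

Lemma cell_prob_ge0 w : 0 <= cell_prob w.
Proof. by rewrite fine_ge0. Qed.

Lemma cell_probS v : cell_prob v = cell_prob (true :: v) + cell_prob (false :: v).
Proof.
rewrite /cell_prob -consistent /= -fineD ?fin_num_measure //; last 2 first.
- by apply: measurableI => //; exact: measurable_cell.
- by apply: measurableI; [exact: measurable_cell|apply: measurableC; exact: mE].
congr fine; rewrite -setDE addeC; apply: measureDI => //; exact: measurable_cell.
Qed.

(** Inside the interval of v, the part for [false] lies on the left and the part for [true] on the
    right. *)
Fixpoint cell_left w : R := if w is b :: v
  then cell_left v + (if b then cell_prob (false :: v) else 0) else 0.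

Definition cell_itv w : set R := `[cell_left w, cell_left w + cell_prob w[%classic.

Lemma cell_itvS b v u : cell_itv (b :: v) u -> cell_itv v u.
Proof.
rewrite /cell_itv /= !in_itv /= [cell_prob v]cell_probS.
have := cell_prob_ge0 (true :: v); have := cell_prob_ge0 (false :: v).
case: b => /=; set p := cell_prob (true :: _); set q := cell_prob (false :: _); lra.
Qed.

Lemma cell_itv_split v u : cell_itv v u ->
  exists b, cell_itv (b :: v) u.
Proof.
rewrite /cell_itv /= in_itv /= [cell_prob v]cell_probS => /andP[u1 u2].
have [h|h] := leP (cell_left v + cell_prob (false :: v)) u.
  by exists true; rewrite /= in_itv /= h; lra.
by exists false; rewrite /= in_itv /= addr0 h u1.
Qed.

Lemma cell_itv_inj v v' u : size v = size v' -> cell_itv v u -> cell_itv v' u -> v = v'.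
Proof.
elim: v v' => [|b v IH] [|b' v'] //= [vv'] uv uv'.
have {vv'} vE := IH _ vv' (cell_itvS uv) (cell_itvS uv').
rewrite vE in uv *; congr cons.
by case: b uv; case: b' uv' => //; rewrite /cell_itv /= !in_itv /=; lra.
Qed.

(** Copy of the test [E k] on the line. Under the uniform law the copies have the joint law of the
    tests, and the countable additivity of Lebesgue measure does the work of an extension
    theorem. *)
Definition code k : set R := [set u | exists2 v, size v = k & cell_itv (true :: v) u].

Lemma measurable_code k : measurable (code k).
Proof.
have -> : code k = \bigcup_v (if size v == k then cell_itv (true :: v) else set0).
  apply/seteqP; split => u.
    by move=> [v vk uv]; exists v => //; rewrite vk eqxx.
  by move=> [v _]; case: eqP => // vk uv; exists v.
apply: countable_bigcupT_measurable; first exact: countableP.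
by move=> v; case: ifP => // _; exact: measurable_itv.
Qed.

Lemma cell_itvE b v :
  cell_itv (b :: v) = cell_itv v `&` (if b then code (size v) else ~` code (size v)).
Proof.
apply/seteqP; split => u.
  move=> ub; split; first exact: cell_itvS ub.
  case: b ub => [ub|ub]; first by exists v.
  move=> [v' vv' uv']; have := cell_itv_inj _ ub uv'.
  by rewrite /= vv' => /(_ erefl) [].
move=> [uv]; case: b; last first.
  move=> nc; have [[] // ub] := cell_itv_split uv.
  by case: nc; exists v.
by move=> [v' vv' uv']; rewrite (cell_itv_inj (esym vv') uv (cell_itvS uv')).
Qed.

Definition bits U (A : nat -> set U) (u : U) : nat -> bool := fun k => u \in A k.

Lemma cell_bits w x : cell w x -> forall k, (k < size w)%N -> bits E x k = nth false (rev w) k.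
Proof.
elim: w => [//|b v IH] [/IH vx xb] k /=; rewrite ltnS rev_cons nth_rcons size_rev.
case: ltngtP => // [kv _|-> _]; first exact: vx.
by case: b xb => h; [exact: mem_set|exact: memNset].
Qed.

Lemma cell_itv_bits w u : cell_itv w u ->
  forall k, (k < size w)%N -> bits code u k = nth false (rev w) k.
Proof.
elim: w => [//|b v IH]; rewrite cell_itvE => -[/IH vx xb] k /=.
rewrite ltnS rev_cons nth_rcons size_rev.
case: ltngtP => // [kv _|-> _]; first exact: vx.
by case: b xb => h; [exact: mem_set|exact: memNset].
Qed.

(** Induction on the number m of bits still free: both sides split along the next bit, until phi is
    constant on the cell, where the length of the interval is by construction the probability of the
    cell. *)
Lemma code_law m w (phi : set (nat -> bool)) : depends_on (size w + m) phi ->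
  [/\ measurable (cell w `&` [set x | phi (bits E x)]),
   measurable (cell_itv w `&` [set u | phi (bits code u)]) &
   lebesgue_measure (cell_itv w `&` [set u | phi (bits code u)]) =
   P (size w + m) (cell w `&` [set x | phi (bits E x)])].
Proof.
elim: m w => [|m IH] w.
  rewrite addn0 => dphi.
  have [h|h] := pselect (phi (nth false (rev w))).
    rewrite (_ : cell w `&` _ = cell w); last first.
      apply/seteqP; split => x; first by case.
      by move=> xw; split => //=; rewrite (dphi _ _ (cell_bits xw)).
    rewrite (_ : cell_itv w `&` _ = cell_itv w); last first.
      apply/seteqP; split => x; first by case.
      by move=> xw; split => //=; rewrite (dphi _ _ (cell_itv_bits xw)).
    split; [exact: measurable_cell|exact: measurable_itv|].
    rewrite lebesgue_measure_itv /= lte_fin.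
    have := cell_prob_ge0 w; rewrite le_eqVlt => /predU1P[p0|p0].
      by rewrite -p0 addr0 ltxx; rewrite /cell_prob in p0;
        rewrite -[RHS]fineK ?fin_num_measure -?p0 //; exact: measurable_cell.
    rewrite ltrDl p0 -EFinB addrAC subrr add0r /cell_prob fineK //.
    by rewrite fin_num_measure //; exact: measurable_cell.
  rewrite (_ : cell w `&` _ = set0); last first.
    apply/seteqP; split => x //= [xw].
    by rewrite (dphi _ _ (cell_bits xw)).
  rewrite (_ : cell_itv w `&` _ = set0) ?measure0 //.
  apply/seteqP; split => x //= [xw].
  by rewrite (dphi _ _ (cell_itv_bits xw)).
rewrite -addSnnS => dphi.
have [mt1 mt2 mt] := IH (true :: w) dphi.
have [mf1 mf2 mf] := IH (false :: w) dphi.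
have e1 : cell w `&` [set x | phi (bits E x)] =
    (cell (true :: w) `&` [set x | phi (bits E x)]) `|`
    (cell (false :: w) `&` [set x | phi (bits E x)]).
  by rewrite -setIUl /= -setIUr setUv setIT.
have e2 : cell_itv w `&` [set u | phi (bits code u)] =
    (cell_itv (true :: w) `&` [set u | phi (bits code u)]) `|`
    (cell_itv (false :: w) `&` [set u | phi (bits code u)]).
  by rewrite -setIUl !cell_itvE -setIUr setUv setIT.
rewrite e1 e2; split; [exact: measurableU|exact: measurableU|].
rewrite !measureU //.
- by congr (_ + _)%E; [exact: mt|exact: mf].
- by apply/seteqP; split => x //= [[[_ h] _] [[_ nh] _]].
- by rewrite !cell_itvE; apply/seteqP; split => x //= [[[_ h] _] [[_ nh] _]].
Qed.

Lemma exists_coding : exists (mu : probability (measurableTypeR R) R) (F : nat -> set R),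
  (forall k, measurable (F k)) /\
  forall m (phi : set (nat -> bool)), depends_on m phi ->
   [/\ measurable [set x | phi (bits E x)], measurable [set u | phi (bits F u)] &
    mu [set u | phi (bits F u)] = P m [set x | phi (bits E x)]].
Proof.
pose f : measurableTypeR R -> R := \1_`[0, 1[%classic.
have mf : measurable_fun setT f by exact: measurable_indic.
have f0 x : 0 <= f x by exact: fun_ge0.
have f1 : (\int[lebesgue_measure]_x (f x)%:E = 1)%E.
  rewrite integral_indic // setIT; apply: (etrans (lebesgue_measure_itv `[0, 1[)).
  rewrite /= lte_fin ltr01.
  by rewrite sube0.
have [mu [muE _]] := exists_density f0 mf f1.
exists mu, code; split; first exact: measurable_code.
move=> m phi dphi.
have [m1 m2 e] := @code_law m [::] _ dphi.
rewrite /= setTI in m1 e.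
have i01 : cell_itv [::] = `[0, 1[%classic.
  by rewrite /cell_itv /= add0r /cell_prob /= probability_setT.
(* Off [[0, 1[] all bits are false, so there the event is everything or nothing. *)
have m3 : measurable [set u | phi (bits code u)].
  suff -> : [set u | phi (bits code u)] = (cell_itv [::] `&` [set u | phi (bits code u)]) `|`
     (~` cell_itv [::] `&` [set u | phi (fun=> false)]).
    apply: measurableU => //.
    have [h|h] := pselect (phi (fun=> false)).
      rewrite (_ : [set u | _] = setT) ?setIT; last by apply/seteqP; split.
      by apply: measurableC; rewrite i01; exact: measurable_itv.
    by rewrite (_ : [set u | _] = set0) ?setI0 //; apply/seteqP; split.
  have no u : ~ cell_itv [::] u -> bits code u = (fun=> false).
    move=> nu; apply/funext => k; apply/negP => /set_mem [v _ uv]; apply: nu.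
    by elim: {k} (true :: v) uv => // b v' IH /cell_itvS.
  apply/seteqP; split => u /= => [pu|].
    have [h|h] := pselect (cell_itv [::] u); [by left|right; split => //].
    by rewrite -(no u h).
  by move=> [[]//|[nu pu]]; rewrite no.
split => //; rewrite muE // integral_indic // -i01 -e.
by rewrite setIC.
Qed.
End coding.

(** * Projective limit of the laws of finitely many coordinates *)

Section projective_limit.
Variable R : realType.
Local Notation T := (borel {ptws nat -> R}).
Variable P : nat -> probability T R.
Hypothesis P_consistent : forall n m (f : T -> \bar R), (n <= m)%N ->
  depends_on n f -> (forall x, 0 <= f x)%E -> measurable_fun setT f ->
  (\int[P m]_x f x = \int[P n]_x f x)%E.

Lemma P_consistent_set n m (A : set T) : measurable A -> depends_on n A ->
  (n <= m)%N -> P m A = P n A.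
Proof.
move=> mA dA nm; rewrite -[A]setIT -!integral_indic //.
have i0 x : (0 <= (\1_A x : R)%:E)%E by rewrite lee_fin.
have mi : measurable_fun setT (fun x : T => (\1_A x : R)%:E).
  by apply/measurable_EFinP; exact: measurable_indic.
apply: P_consistent nm _ i0 mi => x y /dA xy; rewrite !indicE.
by rewrite (_ : (x \in A) = (y \in A)) //; apply/idP/idP => /set_mem h; apply/mem_set;
  rewrite ?xy // -xy.
Qed.

(** Logistic map onto ]0, 1[: a bounded coordinate can be recovered as the supremum of the levels it
    exceeds. *)
Definition squash (x : R) : R := (1 + expR (- x))^-1.
Definition unsquash (y : R) : R := - ln (y^-1 - 1).

Lemma squashK : cancel squash unsquash.
Proof. by move=> x; rewrite /unsquash invrK addrC addKr expRK opprK. Qed.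

Lemma squash_gt0 x : 0 < squash x.
Proof. by rewrite invr_gt0 addr_gt0 ?expR_gt0. Qed.

Lemma squash_lt1 x : squash x < 1.
Proof. by rewrite invf_lt1 ?addr_gt0 ?expR_gt0 // ltrDl expR_gt0. Qed.

Lemma measurable_squash : measurable_fun setT squash.
Proof.
apply: (measurableT_comp (@measurable_invr R)); apply: measurable_funD => //.
by apply: measurableT_comp => //; exact: measurableT_comp.
Qed.

Lemma measurable_unsquash : measurable_fun setT unsquash.
Proof.
apply: measurableT_comp => //; apply: (measurableT_comp (@measurable_ln R)).
by apply: measurable_funB => //; exact: measurable_invr.
Qed.

(** Every pair (coordinate, rational) occurs. The default values, here and in [level], only produce
    tests at level 0, which every point of ]0, 1[ passes. *)
Definition test (m : nat) : nat * rat :=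
  odflt (0%N, 0) (@choice.unpickle (nat * rat)%type m).
Definition level m : R := if 0 <= (test m).2 <= 1 then ratr (test m).2 else 0.
Definition test_set m : set T := [set x | level m < squash (x (test m).1)].
Definition test_bound m : nat := (\sum_(k < m) (test k).1.+1)%N.

Lemma level_itv m : 0 <= level m <= 1.
Proof.
rewrite /level; case: ifP => [/andP[q0 q1]|_]; last by rewrite lexx ler01.
by rewrite ler0q q0 -(rmorph1 (@ratr R)) ler_rat.
Qed.

Lemma test_boundP k m : (k < m)%N -> ((test k).1 < test_bound m)%N.
Proof. by move=> km; rewrite /test_bound (bigD1 (Ordinal km)) //= ltn_addr. Qed.

Lemma test_bound_leq k m : (k <= m)%N -> (test_bound k <= test_bound m)%N.
Proof.
by move=> km; rewrite /test_bound -(subnKC km) big_split_ord /= leq_addr.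
Qed.

Lemma measurable_test_set m : measurable (test_set m).
Proof.
rewrite -[X in measurable X]setTI.
rewrite (_ : test_set m = (fun x : T => squash (x (test m).1)) @^-1` `]level m, +oo[%classic).
  apply: (measurableT_comp measurable_squash (@measurable_nat_coord R _)) => //.
by apply/seteqP; split => x; rewrite /test_set /= in_itv /= andbT.
Qed.

Lemma cell_dep w : depends_on (test_bound (size w)) (cell test_set w).
Proof.
elim: w => [//|b v IH] x y xy /=; rewrite /setI /=.
have -> : cell test_set v x = cell test_set v y.
  by apply: IH => i iv; apply: xy; rewrite (leq_trans iv) // test_bound_leq.
have e : test_set (size v) x = test_set (size v) y.
  by rewrite /test_set /= xy // test_boundP.
by case: (b); rewrite /setC /= e.
Qed.

(* The points [y] of the unit cube are recovered from the tests they pass: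
   [accepts J z (i, a)] holds in the limit J -> oo iff [a < y i]. *)
Definition accepts J (z : nat -> bool) (p : nat * R) : Prop :=
  p.2 < 0 \/ exists m, [/\ (m < J)%N, (test m).1 = p.1, z m & p.2 < level m].

Definition accepts_all J (s : seq (nat * R)) (z : nat -> bool) : Prop :=
  forall p, p \in s -> accepts J z p.

Lemma accepts_all_dep J s : depends_on J (accepts_all J s).
Proof.
move=> x y xy; apply/propext; split => h p /h [|[m [mJ mp xm pm]]]; try by left.
  by right; exists m; rewrite -xy.
by right; exists m; rewrite xy.
Qed.

Lemma accepts_allS J J' s z : (J <= J')%N -> accepts_all J s z -> accepts_all J' s z.
Proof.
move=> JJ' h p /h [|[m [mJ mp zm pm]]]; first by left.
by right; exists m; split => //; exact: leq_trans JJ'.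
Qed.

Lemma accepts_lim s z : (exists J, accepts_all J s z) <->
  forall p, p \in s -> exists J, accepts J z p.
Proof.
split=> [[J h] p ps|]; first by exists J; exact: h.
elim: s => [_|p s IH h]; first by exists 0%N.
have [|J hJ] := IH; first by move=> q qs; apply: h; rewrite inE qs orbT.
have [|J' hJ'] := h p; first by rewrite inE eqxx.
exists (maxn J J') => q; rewrite inE => /predU1P[->|qs].
  have := @accepts_allS J' (maxn J J') [:: p] z (leq_maxr _ _).
  by apply; rewrite ?inE // => _ /[!inE] /eqP ->.
by apply: (@accepts_allS J _ s z) => //; exact: leq_maxl.
Qed.

Lemma squash_accepts (x : T) p :
  (p.2 < squash (x p.1)) <-> exists J, accepts J (bits test_set x) p.
Proof.
split=> [px|[J [p0|[m [_ mp /set_mem xm pm]]]]].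
- have [p0|p0] := ltP p.2 0; first by exists 0%N; left.
  have [q] := rat_in_itvoo px; rewrite in_itv /= => /andP[pq qx].
  have tE : test (choice.pickle (p.1, q)) = (p.1, q) by rewrite /test choice.pickleK.
  have q01 : 0 <= q <= 1.
    rewrite -(ler0q R) (le_trans p0 (ltW pq)) -(ler_rat R) rmorph1.
    exact: ltW (lt_trans qx (squash_lt1 _)).
  have lE : level (choice.pickle (p.1, q)) = ratr q by rewrite /level tE q01.
  exists (choice.pickle (p.1, q)).+1; right; exists (choice.pickle (p.1, q)); split => //.
  + by rewrite tE.
  + by apply/mem_set; rewrite /test_set /= lE tE.
  + by rewrite lE.
- exact: lt_trans (squash_gt0 _).
- by rewrite (lt_trans pm) // -mp.
Qed.

Let sq (x : nat -> R) : T := fun i => squash (x i).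
Let usq (y : nat -> R) : T := fun i => unsquash (y i).

(** The sequence Y rebuilt on the line from the copied tests has, on boxes, the law of the squashed
    sequence, because a box is an increasing union of events on finitely many tests. Undoing the
    squashing gives Q. *)
Lemma exists_projective_limit : exists Q : probability T R,
  forall n (f : T -> \bar R), depends_on n f -> (forall x, 0 <= f x)%E ->
    measurable_fun setT f -> (\int[Q]_x f x = \int[P n]_x f x)%E.
Proof.
have cons w : P (test_bound (size w).+1) (cell test_set w) =
    P (test_bound (size w)) (cell test_set w).
  apply: P_consistent_set; last exact: test_bound_leq.
    by apply: measurable_cell; exact: measurable_test_set.
  exact: cell_dep.
have [mu [F [mF muF]]] :=
  @exists_coding _ _ _ (fun m => P (test_bound m)) _ measurable_test_set cons.
(* The bits of u need not come from any sequence; the added 0 and the bound 1 make the supremum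
   exist for every u. *)
pose vals u i : set R := [set 0] `|` [set level m | m in [set m | (test m).1 = i /\ u \in F m]].
pose Y u : nat -> R := fun i => sup (vals u i).
have Yacc u p : (p.2 < Y u p.1) <-> exists J, accepts J (bits F u) p.
  have ub : ubound (vals u p.1) 1.
    by move=> _ [->|[m _ <-]]; [exact: ler01|have /andP[] := level_itv m].
  have hs : has_sup (vals u p.1) by split; [exists 0; left|exists 1].
  split=> [|[J [p0|[m [_ mp um pm]]]]].
  - move/(sup_gt hs.1) => [_ [->|[m [mp um] <-]] pm]; first by exists 0%N; left.
    by exists m.+1; right; exists m; split.
  - by rewrite (lt_le_trans p0) // ub_le_sup //; [exists 1|left].
  - by rewrite (lt_le_trans pm) // ub_le_sup //; [exists 1|right; exists m].
have mY s : measurable [set u | box s (Y u)].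
  rewrite (_ : [set u | _] = \bigcup_J [set u | accepts_all J s (bits F u)]).
    apply: bigcupT_measurable => J.
    by have [] := muF J _ (@accepts_all_dep J s).
  apply/seteqP; split => u /=.
    move=> /allP bu; have /accepts_lim[J hJ] : forall p, p \in s -> exists J, accepts J (bits F
      u) p.
      by move=> p ps; apply/Yacc; exact: bu.
    by exists J.
  move=> [J _ hJ]; apply/allP => p ps; apply/Yacc.
  by apply: (accepts_lim s _).1 ps; exists J.
have muY n s : (forall p, p \in s -> (p.1 < n)%N) ->
    mu [set u | box s (Y u)] = P n [set x : T | box s (sq x)].
  move=> sn; pose AF J := [set u | accepts_all J s (bits F u)].
  pose AE J : set T := [set x | accepts_all J s (bits test_set x)].
  have AFE : [set u | box s (Y u)] = \bigcup_J AF J.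
    apply/seteqP; split => u /=.
      move=> /allP bu; have /accepts_lim[J hJ] :
          forall p, p \in s -> exists J, accepts J (bits F u) p.
        by move=> p ps; apply/Yacc; exact: bu.
      by exists J.
    move=> [J _ hJ]; apply/allP => p ps; apply/Yacc.
    by apply: (accepts_lim s _).1 ps; exists J.
  have AEE : [set x : T | box s (sq x)] = \bigcup_J AE J.
    apply/seteqP; split => x /=.
      move=> /allP bu; have /accepts_lim[J hJ] :
          forall p, p \in s -> exists J, accepts J (bits test_set x) p.
        by move=> p ps; apply/squash_accepts; exact: bu.
      by exists J.
    move=> [J _ hJ]; apply/allP => p ps; apply/squash_accepts.
    by apply: (accepts_lim s _).1 ps; exists J.
  have mAF J : measurable (AF J) by have [] := muF J _ (@accepts_all_dep J s).
  have mAE J : measurable (AE J) by have [] := muF J _ (@accepts_all_dep J s).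
  have bits_dep x y k : x (test k).1 = y (test k).1 ->
      bits test_set x k = bits test_set y k.
    by move=> xy; apply/idP/idP => /set_mem; rewrite /test_set /= => h;
      apply/mem_set; rewrite /= ?xy // -xy.
  have AEn J : depends_on n (AE J).
    move=> x y xy; apply/propext; split => h p ps; move: (h p ps) => [|[m [mJ mp xm pm]]];
      try (by left); right; exists m; split => //.
      by rewrite -(bits_dep x) // xy // mp sn.
    by rewrite (bits_dep x y) // xy // mp sn.
  have AEJ J : depends_on (test_bound J) (AE J).
    move=> x y xy; apply/propext; split => h p ps; move: (h p ps) => [|[m [mJ mp xm pm]]];
      try (by left); right; exists m; split => //.
      by rewrite -(bits_dep x) // xy // test_boundP.
    by rewrite (bits_dep x y) // xy // test_boundP.
  (* The event depends both on the first n coordinates and on the first [test_bound J] ones;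
     consistency compares the two laws whichever bound is larger. *)
  have muJ J : mu (AF J) = P n (AE J).
    have [_ _ ->] := muF J _ (@accepts_all_dep J s).
    have [nJ|/ltnW Jn] := leqP n (test_bound J);
      first exact: (P_consistent_set (mAE J) (AEn J) nJ).
    by apply/esym; exact: (P_consistent_set (mAE J) (AEJ J) Jn).
  have ndF : nondecreasing_seq AF.
    by move=> J J' JJ'; apply/subsetPset => u /=; exact: accepts_allS.
  have ndE : nondecreasing_seq AE.
    by move=> J J' JJ'; apply/subsetPset => u /=; exact: accepts_allS.
  have cF := @nondecreasing_cvg_mu _ _ _ mu AF mAF (bigcupT_measurable _ mAF) ndF.
  have cE := @nondecreasing_cvg_mu _ _ _ (P n) AE mAE (bigcupT_measurable _ mAE) ndE.
  have eJ : mu \o AF = P n \o AE by apply/funext => J; exact: muJ.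
  by rewrite AFE AEE -(cvg_lim _ cF) // -(cvg_lim _ cE) // eJ.
have mYi i : measurable_fun setT (fun u => Y u i).
  apply: (measurability _ (RGenOInfty.measurableE R)) => //.
  move=> _ [_ [x ->] <-]; rewrite setTI.
  rewrite (_ : _ @^-1` _ = [set u | box [:: (i, x)] (Y u)]); first exact: mY.
  by apply/seteqP; split => u; rewrite /box /= in_itv /= !andbT.
(* Zeroing the coordinates from n on turns any box into a box on the first n coordinates, up to the
   condition [b] below on the other bounds, and leaves the values of f after [usq] unchanged. *)
pose tau n (y : nat -> R) : T := fun i => if (i < n)%N then y i else 0.
have mZ1 n : measurable_fun setT (fun u => tau n (Y u)).
  apply: (measurable_to_borel (@open_ptws_id R nat)) => i; rewrite /tau.
  by case: (i < n)%N => //; exact: measurable_cst.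
have mZ2 n : measurable_fun setT (fun x : T => tau n (sq x)).
  apply: (measurable_to_borel (@open_ptws_id R nat)) => i; rewrite /tau.
  case: (i < n)%N; last exact: measurable_cst.
  exact: (measurableT_comp measurable_squash (@measurable_nat_coord R _)).
have mX : measurable_fun setT ((fun u => usq (Y u)) : measurableTypeR R -> T).
  apply: (measurable_to_borel (@open_ptws_id R nat)) => i.
  exact: (measurableT_comp measurable_unsquash (mYi i)).
have mU : measurable_fun setT (usq : T -> T).
  apply: (measurable_to_borel (@open_ptws_id R nat)) => i.
  exact: (measurableT_comp measurable_unsquash (@measurable_nat_coord R _)).
have [Q [_ QE]] := exists_pushforward mu mX.
exists Q => n f df f0 mf; rewrite QE //.
have [Q1 [Q1A Q1E]] := exists_pushforward mu (mZ1 n).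
have [Q2 [Q2A Q2E]] := exists_pushforward (P n) (mZ2 n).
have Q12 A : measurable A -> Q1 A = Q2 A.
  apply: (borel_measure_unique (@open_ptws_id R nat)) => s.
  have ms := measurable_box (@open_ptws_id R nat) s.
  apply: (etrans (Q1A _ ms)); apply: (etrans _ (esym (Q2A _ ms))).
  pose s' := [seq p <- s | (p.1 < n)%N].
  pose b := all (fun p : nat * R => (p.1 < n)%N || (p.2 < 0)) s.
  have tauE (y : nat -> R) : box s (tau n y) = (b /\ box s' y) :> Prop.
    have e : all (fun p => p.2 < tau n y p.1) s = b && all (fun p => p.2 < y p.1) s'.
      by rewrite all_filter -all_predI; apply: eq_all => p /=; rewrite /tau; case: ifP => _ /=;
        rewrite ?andbT.
    by apply/propext; rewrite /box /= e; split => /andP.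
  rewrite (_ : _ @^-1` _ = [set u | b /\ box s' (Y u)]); last first.
    by apply/seteqP; split => u /=; rewrite tauE.
  rewrite (_ : (fun x : T => tau n (sq x)) @^-1` _ = [set x : T | b /\ box s' (sq x)]);
    last first.
    by apply/seteqP; split => u /=; rewrite tauE.
  have emp U (Z : U -> Prop) : [set x | false /\ Z x] = set0 by apply/seteqP; split => x // [].
  have tru U (Z : U -> Prop) : [set x | true /\ Z x] = [set x | Z x].
    by apply/seteqP; split => x //= [].
  case: b {tauE}; last by rewrite emp (emp _ (fun x => box s' (sq x))) !measure0.
  rewrite tru (tru _ (fun x => box s' (sq x))).
  by apply: muY => p; rewrite mem_filter => /andP[].
pose g (y : T) := f (usq y).
have g0 y : (0 <= g y)%E by exact: f0.
have mg : measurable_fun setT g by exact: measurableT_comp mU.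
have gtau y : g (tau n y) = g y.
  by apply: df => i ni; rewrite /usq /tau /= ni.
transitivity (\int[Q1]_y g y)%E.
  by rewrite Q1E //; apply: eq_integral => u _; rewrite gtau.
transitivity (\int[Q2]_y g y)%E; first by apply: eq_measure_integral => A mA _; exact: Q12.
rewrite Q2E //; apply: eq_integral => x _; rewrite gtau /g; congr f.
by apply/funext => i; rewrite /usq /sq squashK.
Qed.
End projective_limit.

(** * Positive fields and integer points of their Laplace transform *)

Section threshold.
Variable R : realType.

(* (1 - e^(-n x))^N is about exp (- N e^(-n x)), which for N = n e^(n a) tends to
   the indicator of a < x. *)
Definition cutoff_exp (a : R) n : nat := (Num.truncn (n%:R * expR (n%:R * a))).+1.

Definition cutoff (a : R) n (x : R) : R :=
  (1 - expR (- (n%:R * x))) ^+ cutoff_exp a n.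

Lemma onem_expr_bounds (y : R) N : 0 <= y <= 1 ->
  1 - N%:R * y <= (1 - y) ^+ N <= expR (- (N%:R * y)).
Proof.
move=> /andP[y0 y1]; apply/andP; split.
  elim: N => [|N IH]; first by rewrite mul0r subr0 expr0.
  have y1' : 0 <= 1 - y by rewrite subr_ge0.
  have := ler_wpM2l y1' IH; rewrite -exprS; apply: le_trans.
  by rewrite -natr1; have := ler0n R N; nra.
rewrite -mulrN expRM_natl; apply: lerXn2r; rewrite ?nnegrE ?expR_ge0 ?subr_ge0 //.
by have := expR_ge1Dx (- y).
Qed.

Lemma cutoff_itv (a x : R) n : 0 < x -> 0 <= cutoff a n x <= 1.
Proof.
move=> x0.
have e1 : expR (- (n%:R * x)) <= 1.
  by rewrite -expR0 ler_expR oppr_le0 mulr_ge0 // ltW.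
have e0 := expR_ge0 (- (n%:R * x)).
by rewrite exprn_ge0 ?subr_ge0 //= exprn_ile1 // ?subr_ge0 // gerBl.
Qed.

Lemma cvg_natr_expR (c : R) : 0 < c -> n%:R * expR (- (n%:R * c)) @[n --> \oo] --> 0.
Proof.
move=> c0.
apply: (squeeze_cvgr (f := cst 0) (h := fun n => 4 / c ^+ 2 * n%:R^-1)).
- near=> n; rewrite mulr_ge0 ?expR_ge0 //=.
  have n0 : 0 < n%:R :> R by rewrite ltr0n; near: n; exact: nbhs_infty_gt.
  apply: le_trans (ler_wpM2l (ltW n0) (expRN_le (mulr_gt0 n0 c0))) _.
  rewrite le_eqVlt; apply/orP; left; apply/eqP.
  by field; rewrite !gt_eqF.
- exact: cvg_cst.
- rewrite -[X in _ --> X](mulr0 (4 / c ^+ 2)); apply: cvgMr.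
  by rewrite -cvg_shiftS; exact: cvg_harmonic.
Unshelve. all: by end_near. Qed.

Lemma cvg_expRN (c : R) : 0 < c -> expR (- (n%:R * c)) @[n --> \oo] --> 0.
Proof.
move=> c0; apply: (squeeze_cvgr _ (cvg_cst 0) (cvg_natr_expR c0)).
near=> n; rewrite expR_ge0 /= ler_peMl ?expR_ge0 // ler1n.
by near: n; exact: nbhs_infty_gt.
Unshelve. all: by end_near. Qed.

(** By [onem_expr_bounds] everything depends on N e^(-n x), which tends to 0 for a < x. For x <= a
    it is at least n: the prefactor n in N settles x = a, where the strict indicator is 0. *)
Lemma cutoff_cvg (a x : R) : 0 < x -> cutoff a n x @[n --> \oo] --> ((a < x)%R%:R : R).
Proof.
move=> x0.
have b n : 1 - (cutoff_exp a n)%:R * expR (- (n%:R * x)) <= cutoff a n x <=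
    expR (- ((cutoff_exp a n)%:R * expR (- (n%:R * x)))).
  apply: onem_expr_bounds; rewrite expR_ge0 -[leRHS]expR0 ler_expR oppr_le0.
  by rewrite mulr_ge0 // ltW.
have Nl n : n%:R * expR (n%:R * a) <= (cutoff_exp a n)%:R.
  by rewrite ltW // truncnS_gt.
have Nr n : (cutoff_exp a n)%:R <= n%:R * expR (n%:R * a) + 1.
  rewrite -natr1 lerD2r truncn_le // mulr_ge0 // expR_ge0.
have [ax|xa] := ltP a x.
  apply: (squeeze_cvgr (h := cst 1) (f := fun n : nat => 1 - (n%:R * expR (- (n%:R * (x - a)))
    + expR (- (n%:R * x))))).
  - near=> n; have /andP[b1 _] := b n.
    have /andP[_ ->] := cutoff_itv a n x0; rewrite andbT (le_trans _ b1) // lerB //.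
    have := ler_wpM2r (expR_ge0 (- (n%:R * x))) (Nr n) => /le_trans; apply.
    rewrite mulrDl mul1r -mulrA -expRD le_eqVlt; apply/orP; left; apply/eqP.
    by congr (_ * expR _ + _); ring.
  - rewrite -[X in _ --> X]subr0 -[X in 1 - X]addr0; apply: cvgB; first exact: cvg_cst.
    apply: cvgD; first by apply: cvg_natr_expR; rewrite subr_gt0.
    exact: cvg_expRN.
  - exact: cvg_cst.
apply: (squeeze_cvgr (f := cst 0) (h := fun n : nat => expR (- n%:R))).
- near=> n; have /andP[_ b2] := b n.
  have /andP[-> _] := cutoff_itv a n x0; rewrite (le_trans b2) // ler_expR lerN2.
  have := ler_wpM2r (expR_ge0 (- (n%:R * x))) (Nl n); apply: le_trans.
  rewrite -mulrA -expRD -mulrBr; apply: ler_peMr => //.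
  by rewrite -expR0 ler_expR mulr_ge0 // subr_ge0.
- exact: cvg_cst.
- by have := cvg_expRN ltr01; under eq_fun do rewrite mulr1.
Unshelve. all: by end_near. Qed.

Section transform.
Variable I : eqType.

Definition lap (t : seq (I * nat)) (x : I -> R) : R :=
  expR (- \sum_(p <- t) p.2%:R * x p.1).

Definition lap_fac (s : seq (I * nat)) (x : I -> R) : R :=
  \prod_(p <- s) (1 - expR (- (p.2%:R * x p.1))).

Lemma lap_cons p t x : lap (p :: t) x = expR (- (p.2%:R * x p.1)) * lap t x.
Proof. by rewrite /lap big_cons opprD expRD. Qed.

Lemma lap_fac_cons p s x :
  lap_fac (p :: s) x = (1 - expR (- (p.2%:R * x p.1))) * lap_fac s x.
Proof. by rewrite /lap_fac big_cons. Qed.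

Lemma expRN_itv (n : nat) (y : R) : 0 < y -> 0 <= expR (- (n%:R * y)) <= 1.
Proof.
by move=> y0; rewrite expR_ge0 -[leRHS]expR0 ler_expR oppr_le0 mulr_ge0 // ltW.
Qed.

Lemma lap_itv t s x : (forall i, 0 < x i) -> 0 <= lap t x * lap_fac s x <= 1.
Proof.
move=> x0.
have /andP[l0 l1] : 0 <= lap t x <= 1.
  elim: t => [|p t /andP[IH0 IH1]]; first by rewrite /lap big_nil oppr0 expR0 ler01 lexx.
  have /andP[e0 e1] := expRN_itv p.2 (x0 p.1).
  by rewrite lap_cons mulr_ge0 //= mulr_ile1.
have /andP[f0 f1] : 0 <= lap_fac s x <= 1.
  elim: s => [|p s /andP[IH0 IH1]]; first by rewrite /lap_fac big_nil ler01 lexx.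
  have /andP[e0 e1] := expRN_itv p.2 (x0 p.1).
  by rewrite lap_fac_cons mulr_ge0 ?subr_ge0 //= mulr_ile1 ?subr_ge0 // gerBl.
by rewrite mulr_ge0 //= mulr_ile1.
Qed.

Definition cutoffs (s : seq (I * R)) n (x : I -> R) : R :=
  \prod_(p <- s) cutoff p.2 n (x p.1).

(** The power in [cutoff] becomes a repetition of factors in a list, which [integral_lap_cons]
    expands one by one. *)
Lemma cutoffsE s n x : cutoffs s n x =
  lap_fac (flatten [seq nseq (cutoff_exp p.2 n) (p.1, n) | p <- s]) x.
Proof.
rewrite /cutoffs /lap_fac big_flatten big_map; apply: eq_bigr => p _.
by rewrite big_nseq -[in LHS]/(_ ^+ _) iter_mulr mulr1.
Qed.

Lemma cutoffs_cvg s x : (forall i, 0 < x i) ->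
  cutoffs s n x @[n --> \oo] --> (\1_(box s) x : R).
Proof.
move=> x0; rewrite indicE (_ : (x \in box s) = all (fun p => p.2 < x p.1) s); last first.
  by apply/idP/idP => [/set_mem //|h]; exact: mem_set.
rewrite /cutoffs; elim: s => [|p s IH] /=.
  by under eq_fun do rewrite big_nil; exact: cvg_cst.
under eq_fun do rewrite big_cons.
rewrite -mulnb natrM; apply: cvgM => //; exact: cutoff_cvg.
Qed.

Section integrals.
Context d (T : measurableType d) (P : probability T R) (X : T -> I -> R).
Hypotheses (mX : forall i, measurable_fun setT (fun u => X u i))
  (X0 : forall u i, 0 < X u i).

Lemma measurable_lap t s : measurable_fun setT (fun u => lap t (X u) * lap_fac s (X u)).
Proof.
have me p : measurable_fun setT (fun u => expR (- (p.2%:R * X u p.1))).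
  by apply: measurableT_comp => //; apply: measurableT_comp => //; exact: measurable_funM.
apply: measurable_funM.
  elim: t => [|p t IH].
    by under eq_fun do rewrite /lap big_nil; exact: measurable_cst.
  by under eq_fun do rewrite lap_cons; exact: measurable_funM.
elim: s => [|p s IH].
  by under eq_fun do rewrite /lap_fac big_nil; exact: measurable_cst.
under eq_fun do rewrite lap_fac_cons.
by apply: measurable_funM => //; exact: measurable_funB.
Qed.

Lemma integrable_lap t s :
  P.-integrable setT (EFin \o (fun u => lap t (X u) * lap_fac s (X u))).
Proof.
apply: le_integrable (finite_measure_integrable_cst P 1 measurableT) => //.
  by apply/measurable_EFinP; exact: measurable_lap.
move=> u _ /=; rewrite lee_fin normr1.
by have /andP[h0 h1] := lap_itv t s (X0 u); rewrite ger0_norm.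
Qed.

Lemma integral_lap_cons t p s :
  (\int[P]_u (lap t (X u) * lap_fac (p :: s) (X u))%:E =
   \int[P]_u (lap t (X u) * lap_fac s (X u))%:E -
   \int[P]_u (lap (p :: t) (X u) * lap_fac s (X u))%:E)%E.
Proof.
rewrite -integralB //; [|exact: integrable_lap|exact: integrable_lap].
apply: eq_integral => u _; rewrite -EFinB; congr (_%:E).
by rewrite lap_fac_cons lap_cons; ring.
Qed.

Lemma measurable_box_preimage s : measurable [set u | box s (X u)].
Proof.
elim: s => [|p s IH]; first by rewrite (_ : [set u | _] = setT) //; apply/seteqP; split.
rewrite (_ : [set u | _] = (fun u => X u p.1) @^-1` `]p.2, +oo[%classic `&` [set u | box s (X
  u)]).
  apply: measurableI => //; rewrite -[X in measurable X]setTI.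
  by apply: mX => //; exact: measurable_itv.
by apply/seteqP; split => u; rewrite /box /= in_itv /= andbT => /andP.
Qed.

Lemma integral_cutoffs_cvg s :
  (\int[P]_u (cutoffs s n (X u))%:E @[n --> \oo] --> P [set u | box s (X u)])%E.
Proof.
have mc n : measurable_fun setT (fun u => (cutoffs s n (X u))%:E).
  apply/measurable_EFinP; under eq_fun do rewrite cutoffsE -[lap_fac _ _]mul1r.
  have := measurable_lap [::] (flatten [seq nseq (cutoff_exp p.2 n) (p.1, n) | p <- s]).
  by under eq_fun do rewrite {1}/lap big_nil oppr0 expR0.
have mi : measurable_fun setT (fun u => (\1_[set u | box s (X u)] u)%:E : \bar R).
  by apply/measurable_EFinP; apply: measurable_indic; exact: measurable_box_preimage.
have [] := @dominated_convergence _ T R P setT measurableT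
  (fun n u => (cutoffs s n (X u))%:E) (fun u => (\1_[set u | box s (X u)] u)%:E) (cst 1%E) mc mi.
- apply: aeW => u _; apply: cvg_EFin; first exact: nearW.
  have := @cutoffs_cvg s _ (X0 u); rewrite !indicE.
  by congr (_ --> _).
- exact: (finite_measure_integrable_cst P 1 measurableT).
- apply: aeW => u n _; rewrite lee_fin cutoffsE.
  have /andP[] := lap_itv [::] (flatten [seq nseq (cutoff_exp p.2 n) (p.1, n) | p <- s]) (X0 u).
  by rewrite {1 2}/lap big_nil oppr0 expR0 mul1r => h0 h1; rewrite ger0_norm.
by move=> _ _; rewrite integral_indic ?setIT //; exact: measurable_box_preimage.
Qed.

End integrals.

(** Expanding the factors reduces the integrals of [cutoffs] to integer Laplace transforms, and
    dominated convergence yields the boxes. The two spaces may differ: the second law will also be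
    an inverse Gaussian law on R (marginals) and the product of nu with itself (independence). *)
Lemma laplace_box_unique d1 d2 (T1 : measurableType d1) (T2 : measurableType d2)
    (P1 : probability T1 R) (P2 : probability T2 R) (X1 : T1 -> I -> R) (X2 : T2 -> I -> R) :
  (forall i, measurable_fun setT (fun u => X1 u i)) -> (forall u i, 0 < X1 u i) ->
  (forall i, measurable_fun setT (fun u => X2 u i)) -> (forall u i, 0 < X2 u i) ->
  (forall t, \int[P1]_u (lap t (X1 u))%:E = \int[P2]_u (lap t (X2 u))%:E)%E ->
  forall s, P1 [set u | box s (X1 u)] = P2 [set u | box s (X2 u)].
Proof.
move=> m1 p1 m2 p2 e s.
have e' s' t : (\int[P1]_u (lap t (X1 u) * lap_fac s' (X1 u))%:E =
    \int[P2]_u (lap t (X2 u) * lap_fac s' (X2 u))%:E)%E.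
  elim: s' t => [|p s' IH] t; last by rewrite !integral_lap_cons // !IH.
  under eq_integral do rewrite /lap_fac big_nil mulr1.
  by under [RHS]eq_integral do rewrite /lap_fac big_nil mulr1.
have c1 := @integral_cutoffs_cvg _ _ P1 X1 m1 p1 s.
have c2 := @integral_cutoffs_cvg _ _ P2 X2 m2 p2 s.
rewrite -(cvg_lim _ c1) // -(cvg_lim _ c2) //.
set f1 := fun n => _; set f2 := (fun n => \int[P2]_u _)%E.
suff -> : f1 = f2 by [].
apply/funext => n; rewrite /f1 /f2.
have := e' (flatten [seq nseq (cutoff_exp p.2 n) (p.1, n) | p <- s]) [::].
under eq_integral do rewrite {1}/lap big_nil oppr0 expR0 mul1r -cutoffsE.
by under [X in _ = X -> _]eq_integral do rewrite {1}/lap big_nil oppr0 expR0 mul1r -cutoffsE.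
Qed.

End transform.
End threshold.

(** * Countability of the graph; sums over edges *)

Section graph_facts.
Variables (V : choiceType) (G : graph V).

Lemma adj_sym i j : adj G i j = adj G j i.
Proof. by rewrite /adj fsetUC. Qed.

Lemma adj_irrefl i : adj G i i = false.
Proof.
by apply/negP => /edge_card2; rewrite fsetUid cardfs1.
Qed.

Lemma edgeP e : edge G e -> exists a b, [/\ a != b, e = [fset a; b] & adj G a b].
Proof.
move=> ee; have e2 := edge_card2 ee.
have /fset0Pn[a ae] : e != fset0 by rewrite -cardfs_gt0 e2.
have /cardfs1P[b eb] : #|` (e `\ a)%fset| == 1%N.
  by move: e2; rewrite (cardfsD1 a) ae add1n => -[->].
have eE : e = [fset a; b] by rewrite -eb fsetD1K.
exists a, b; split => //; last by rewrite /adj -eE.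
by have := in_fset1 b b; rewrite -eb !inE eq_sym eqxx => /andP[].
Qed.

(** Walks of length n from a root end in a finite set, by local finiteness, and connectedness makes
    these sets cover V. *)
Lemma graph_countable : exists iota : V -> nat, injective iota.
Proof.
suff /countable_injP[f fi] : countable [set: V].
  by exists f => x y; apply: fi; rewrite inE.
have [[r _]|nV] := pselect (exists r : V, True); last first.
  rewrite (_ : [set: V] = set0); first exact: countable0.
  by apply/seteqP; split => // v _; apply: nV; exists v.
pose reach n := [set v | exists p, [/\ size p = n, path (adj G) r p & last r p = v]].
have -> : [set: V] = \bigcup_n reach n.
  apply/seteqP; split => // v _; have [p [pp pv]] := edge_connected G r v.
  by exists (size p) => //; exists p.
apply: bigcup_countable => [|n _]; first exact: countableP.
apply: finite_set_countable; elim: n => [|n IH].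
  apply: sub_finite_set (finite_set1 r) => v [p [/size0nil -> _ <-]].
  by [].
apply: sub_finite_set (bigcup_finite IH (fun u _ => edge_locally_finite G u)).
move=> v [p []]; elim/last_ind: p => // p u _.
rewrite size_rcons rcons_path last_rcons => -[pn] /andP[pp pu] <-.
by exists (last r p) => //; exists p.
Qed.

End graph_facts.

Section edge_sums.
Variables (R : realType) (V : choiceType) (G : graph V).

Lemma sum_pairs_of_edge (U : {fset V}) (a b : V) : a \in U -> b \in U -> a != b ->
  \sum_(u <- U) \sum_(v <- U) (([fset u; v] == [fset a; b])%:R : R) = 2.
Proof.
move=> aU bU ab.
have e u v : ([fset u; v] == [fset a; b]) = ((u == a) && (v == b)) || ((u == b) && (v == a)).
  apply/eqP/idP => [E|/orP[/andP[/eqP-> /eqP->]//|/andP[/eqP-> /eqP->]]]; last by rewrite fsetUC.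
  have : u \in [fset a; b] by rewrite -E !inE eqxx.
  have : v \in [fset a; b] by rewrite -E !inE eqxx orbT.
  have : a \in [fset u; v] by rewrite E !inE eqxx.
  have : b \in [fset u; v] by rewrite E !inE eqxx orbT.
  rewrite !inE; do 4 (move=> /orP[] /eqP ?); subst; rewrite ?eqxx ?orbT //=;
    rewrite eqxx in ab; done.
have s1 x (xU : x \in U) : \sum_(v <- U) ((v == x)%:R : R) = 1.
  rewrite (big_fsetD1 x) //= eqxx big1_seq ?addr0 // => v.
  by rewrite !inE => /andP[_ /andP[/negbTE ->]].
rewrite (eq_bigr (fun u => (u == a)%:R + (u == b)%:R)) => [|u _].
  by rewrite big_split /= !s1.
have [->|ua] := eqVneq u a.
  rewrite (negbTE ab) addr0 -[RHS](s1 b) //; apply: eq_bigr => v _.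
  by rewrite e eqxx (negbTE ab) /= orbF.
have [->|ub] := eqVneq u b.
  rewrite add0r -[RHS](s1 a) //; apply: eq_bigr => v _.
  by rewrite e eqxx eq_sym (negbTE ab).
rewrite addr0 big1 // => v _.
by rewrite e (negbTE ua) (negbTE ub).
Qed.

(** An edge inside U comes from exactly two ordered pairs of vertices, by [sum_pairs_of_edge]. *)
Lemma sum_edges (U : {fset V}) (f : {fset V} -> R) :
  \sum_(u <- U) \sum_(v <- U) (if adj G u v then f [fset u; v] else 0) =
  2 * \sum_(e <- fpowerset U | edge G e) f e.
Proof.
rewrite mulr_sumr.
have step u v : u \in U -> v \in U -> (if adj G u v then f [fset u; v] else 0) =
   \sum_(e <- fpowerset U | edge G e) f e * ([fset u; v] == e)%:R.
  move=> uU vU; case: ifPn => [auv|nauv]; last first.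
    rewrite big1 // => e ee; case: eqP => [uve|_]; last by rewrite mulr0.
    by rewrite /adj uve ee in nauv.
  rewrite big_mkcond (big_fsetD1 [fset u; v]) /=; last first.
    by rewrite fpowersetE; apply/fsubsetP => x; rewrite !inE => /orP[] /eqP ->.
  rewrite -/(adj G u v) auv eqxx mulr1 big1_seq ?addr0 // => e /andP[_].
  by rewrite !inE eq_sym => /andP[/negbTE -> _]; rewrite mulr0 if_same.
transitivity (\sum_(u <- U) \sum_(v <- U) \sum_(e <- fpowerset U | edge G e)
    f e * (([fset u; v] == e)%:R)).
  apply: eq_big_seq => u uU; apply: eq_big_seq => v vU; exact: step.
under eq_bigr do rewrite exchange_big /=.
rewrite exchange_big /=.
rewrite big_seq_cond [RHS]big_seq_cond; apply: eq_bigr => e /andP[].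
rewrite fpowersetE => /fsubsetP eU /edgeP[a [b [ab eE _]]].
under eq_bigr do rewrite -mulr_sumr.
rewrite -mulr_sumr eE sum_pairs_of_edge //; first exact: mulrC.
- by apply: eU; rewrite eE !inE eqxx.
- by apply: eU; rewrite eE !inE eqxx orbT.
Qed.

End edge_sums.

(** * The Laplace exponent as a single double sum *)

Section laplace_exponent.
Variables (R : realType) (V : choiceType) (G : graph V) (W : {fset V} -> R).

Lemma conductance_sym u v : conductance_op G W u v = conductance_op G W v u.
Proof. by rewrite /conductance_op adj_sym fsetUC. Qed.

Lemma sum_fset_split (S U : {fset V}) (F : V -> R) : (U `<=` S)%fset ->
  \sum_(x <- S) F x = \sum_(x <- U) F x + \sum_(x <- (S `\` U)%fset) F x.
Proof.
move=> /fsubsetP US; rewrite (big_fsetID _ (mem U)) /=; congr (_ + _).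
  rewrite (_ : [fset x in S | x \in U]%fset = U) //; apply/fsetP => x.
  by rewrite !inE andb_idl //; exact: US.
by congr (bigop _ _); congr enum_fset; apply/fsetP => x; rewrite !inE andbC.
Qed.

(** Setting sg = 1 outside U merges interior and boundary edges. In the double sum over S, pairs
    inside U give the interior edges twice, pairs with one end in U the boundary edges twice, and
    the other pairs vanish. *)
Lemma laplace_exponentE (U S : {fset V}) (lam sg : V -> R) :
  (U `<=` S)%fset -> (forall u v, u \in U -> adj G u v -> v \in S) ->
  (forall u, u \in U -> 0 <= lam u) ->
  (forall u, u \in U -> sg u = Num.sqrt (1 + lam u)) ->
  (forall u, u \notin U -> sg u = 1) ->
  (\sum_(u <- S) \sum_(v <- S) conductance_op G W u v * (sg u * sg v - 1)) / 2 =
  \sum_(e <- fpowerset U | edge G e) W e * (Num.sqrt (\prod_(k <- e) (1 + lam k)) - 1) +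
  \sum_(i <- U) \sum_(j \in [set j | adj G i j /\ j \notin U])
             W [fset i; j] * (Num.sqrt (1 + lam i) - 1).
Proof.
move=> US NS lam0 sgU sgC; pose A u v := conductance_op G W u v * (sg u * sg v - 1).
pose D := (S `\` U)%fset.
have ADD u v : u \in D -> v \in D -> A u v = 0.
  rewrite !inE => /andP[uU _] /andP[vU _].
  by rewrite /A !sgC // mulr1 subrr mulr0.
have AC u v : A u v = A v u by rewrite /A conductance_sym [sg u * _]mulrC.
have -> : \sum_(u <- S) \sum_(v <- S) A u v =
    \sum_(u <- U) \sum_(v <- U) A u v + 2 * \sum_(u <- U) \sum_(v <- D) A u v.
  rewrite (sum_fset_split _ US).
  under eq_bigr do rewrite (sum_fset_split _ US).
  under [X in _ + X]eq_bigr do rewrite (sum_fset_split _ US).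
  rewrite !big_split /= -/D [X in _ + (_ + X)]big1_seq; last first.
    by move=> u /andP[_ uD]; rewrite big1_seq // => v /andP[_ vD]; exact: ADD.
  rewrite [X in _ + (X + _)]exchange_big /=.
  under [X in _ + (X + _)]eq_bigr => u _ do under eq_bigr => v _ do rewrite AC.
  by rewrite addr0 -addrA mulr_natl mulr2n.
pose f e := W e * (Num.sqrt (\prod_(k <- e) (1 + lam k)) - 1).
have -> : \sum_(u <- U) \sum_(v <- U) A u v =
    \sum_(u <- U) \sum_(v <- U) (if adj G u v then f [fset u; v] else 0).
  apply: eq_big_seq => u uU; apply: eq_big_seq => v vU.
  rewrite /A /conductance_op; case: ifPn => [uv|]; last by rewrite mul0r.
  have uv' : u != v by apply: contraTneq uv => ->; rewrite adj_irrefl.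
  rewrite /f big_fsetU1 ?inE //= big_seq_fset1 !sgU // sqrtrM //.
  by rewrite addr_ge0 // lam0.
rewrite sum_edges mulrDl mulrC mulKf ?pnatr_eq0 // [2 * _]mulrC mulfK ?pnatr_eq0 //.
congr (_ + _); apply: eq_big_seq => u uU.
have fN : finite_set [set j | adj G u j /\ j \notin U].
  by apply: sub_finite_set (edge_locally_finite G u) => j [].
rewrite fsbig_finite //=.
rewrite [RHS](eq_big_seq (fun v => A u v)); last first.
  move=> v; rewrite in_fset_set // inE => -[uv vU].
  by rewrite /A /conductance_op uv sgU // sgC // mulr1.
apply/esym/big_fset_incl.
  apply/fsubsetP => v; rewrite in_fset_set // !inE => -[uv ->] /=.
  exact: NS uv.
move=> v; rewrite !inE => /andP[vU _]; rewrite in_fset_set // notin_setE /= => nv.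
rewrite /A /conductance_op; case: ifPn => [uv|]; last by rewrite mul0r.
by case: nv.
Qed.

End laplace_exponent.

Section reindex.
Variables (R : Type) (idx : R) (op : Monoid.com_law idx).
Variables (V : choiceType) (iota : V -> nat).
Hypothesis iota_inj : injective iota.

Lemma big_iota (U : {fset V}) M (F : nat -> R) :
  (forall v, v \in U -> (iota v < M)%N) ->
  (forall n, (forall v, v \in U -> iota v <> n) -> F n = idx) ->
  \big[op/idx]_(0 <= n < M) F n = \big[op/idx]_(v <- U) F (iota v).
Proof.
move=> UM F0; rewrite -(big_map iota xpredT F).
rewrite (bigID (mem (map iota U))) /= [X in op _ X]big1 ?Monoid.mulm1; last first.
  by move=> n nU; apply: F0 => v vU vn; move/mapP: nU; apply; exists v.
rewrite -big_filter; apply: perm_big; apply: uniq_perm.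
- by rewrite filter_uniq // iota_uniq.
- by rewrite map_inj_uniq.
move=> n; rewrite mem_filter mem_index_iota /=.
by apply/andP/idP => [[]//|nU]; split => //; move/mapP: nU => [v vU ->]; exact: UM.
Qed.

End reindex.

(** * Existence of the law *)

Section existence.
Variables (R : realType) (V : choiceType) (G : graph V) (W : {fset V} -> R).
Hypothesis W_gt0 : forall e, edge G e -> 0 < W e.
Variables (iota : V -> nat) (iota_inj : injective iota).
Local Notation vertex_at := (vertex_at iota).
Local Notation T := (borel {ptws nat -> R}).

(** Integers that code no vertex become isolated points, whose coordinates [potential] does not
    read. *)
Definition nat_conductance i j : R :=
  if vertex_at i is Some u then
    if vertex_at j is Some v then conductance_op G W u v else 0
  else 0.

Lemma nat_conductanceE u v :
  nat_conductance (iota u) (iota v) = conductance_op G W u v.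
Proof. by rewrite /nat_conductance !vertex_atK. Qed.

Lemma nat_conductance_sym i j : nat_conductance i j = nat_conductance j i.
Proof.
by rewrite /nat_conductance; case: (vertex_at i) => [u|]; case: (vertex_at j) => [v|] //;
  exact: conductance_sym.
Qed.

Lemma nat_conductance_ge0 i j : 0 <= nat_conductance i j.
Proof.
rewrite /nat_conductance; case: (vertex_at i) => [u|//]; case: (vertex_at j) => [v|//].
by rewrite /conductance_op; case: ifP => // /W_gt0 /ltW.
Qed.

Lemma nat_conductance_bound : exists B : nat -> nat, forall n i j,
  (i <= n)%N -> (B n <= j)%N -> nat_conductance i j = 0.
Proof.
have rowb i : exists b, forall j, (b <= j)%N -> nat_conductance i j = 0.
  rewrite /nat_conductance; case: (vertex_at i) => [u|]; last by exists 0%N.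
  exists (\max_(v <- fset_set [set v | adj G u v]) iota v).+1 => j bj.
  case vj : (vertex_at j) => [v|//]; rewrite /conductance_op; case: ifP => // uv.
  have jE := vertex_at_Some vj; rewrite -jE in bj.
  suff /leq_ltn_trans/(_ bj) : (iota v <= \max_(v <- fset_set [set v | adj G u v]) iota v)%N.
    by rewrite ltnn.
  apply: (@leq_bigmax_seq _ _ xpredT iota v) => //.
  by rewrite in_fset_set ?inE //; exact: edge_locally_finite.
have [b bP] := choice rowb.
exists (fun n => \max_(i < n.+1) b i) => n i j; rewrite -ltnS => ni Bj.
by apply: bP; apply: leq_trans Bj; exact: (leq_bigmax (Ordinal ni)).
Qed.

Definition potential (x : nat -> R) : V -> R := fun v => beta nat_conductance x (iota v).

(** On a finite U the quadratic form of H_beta is [schur_form] at k = 0, evaluated at the extension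
    of y by zero. Thanks to [pos] it is positive for every sequence x, so no null set has to be
    removed. *)
Lemma potential_DV x : potential x \in DV_set G W.
Proof.
apply/mem_set => U y [i0 yi0].
pose M := (\max_(v <- U) iota v).+1.
have UM v : v \in U -> (iota v < M)%N.
  by move=> vU; rewrite ltnS; exact: (@leq_bigmax_seq _ _ xpredT iota v).
pose z v : R := if insub v is Some u then y u else 0.
pose y' n : R := if vertex_at n is Some v then z v else 0.
have y'E v : y' (iota v) = z v by rewrite /y' vertex_atK.
have y'0 n : (forall v, v \in U -> iota v <> n) -> y' n = 0.
  move=> nU; rewrite /y'; case vn : (vertex_at n) => [v|//]; rewrite /z insubN //.
  by apply/negP => vU; apply: nU vU (vertex_at_Some vn).
have : 0 < schur_form nat_conductance M x y' 0.
  apply: (schur_form_gt0 nat_conductance_sym); exists (iota (val i0)).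
    by rewrite /= UM //; exact: valP.
  by rewrite y'E /z valK.
rewrite /schur_form (big_iota _ iota_inj (U := U)) //; last first.
  by move=> n /y'0 ->; rewrite big1 // => j _; rewrite !mul0r.
under eq_bigr => u _.
  rewrite (big_iota _ iota_inj (U := U)) //; last by move=> n /y'0 ->; rewrite mulr0.
  over.
rewrite (big_seq_fsetE _ U predT) /=; congr (_ < _).
apply: eq_bigr => u _; rewrite (big_seq_fsetE _ U predT) /=; apply: eq_bigr => v _.
rewrite !y'E /z !valK nat_conductanceE /schrodinger_op; congr (_ * (_ + _) * _).
by rewrite (inj_eq iota_inj).
Qed.

Definition field (x : T) : DV G W := exist _ (potential x : {ptws V -> R}) (potential_DV x).

Lemma measurable_field : measurable_fun setT (field : T -> borel (DV G W)).
Proof.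
apply: (@measurable_to_borel R (vertex_countType iota_inj) (DV G W) _ (fun b => val b)
  (@open_DV R V G W)).
by move=> v; exact: measurable_beta.
Qed.

Lemma exists_field_law : exists nu : probability (borel (DV G W)) R, has_laplace_nu nu.
Proof.
have [B Bbound] := nat_conductance_bound.
have [Q QE] := exists_projective_limit (@law_consistent R _
  (@measurable_exit_rate R nat_conductance B)
  (@exit_rate_ge0 R nat_conductance B nat_conductance_ge0)).
have [nu [_ nuE]] := exists_pushforward Q measurable_field.
exists nu => U lam lam0.
have mlap : measurable_fun setT
    (fun b : borel (DV G W) => (expR (- \sum_(i <- U) lam i * val b i))%:E).
  apply/measurable_EFinP; apply: measurableT_comp => //; apply: measurableT_comp => //.
  apply: measurable_sum => v; apply: measurable_funM => //.
  exact: (@measurable_coord R (vertex_countType iota_inj) (DV G W) _ (fun b => val b) (@open_DV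
    R V G W)).
have lap0 (b : borel (DV G W)) : (0 <= (expR (- \sum_(i <- U) lam i * val b i))%:E)%E.
  by rewrite lee_fin expR_ge0.
rewrite (nuE _ lap0 mlap).
pose N := (\max_(v <- U) iota v).+1.
have UN v : v \in U -> (iota v < N)%N.
  by move=> vU; rewrite ltnS; exact: (@leq_bigmax_seq _ _ xpredT iota v).
(* N exceeds the codes of U; M also exceeds the codes of all neighbours of vertices with code below
   N. *)
pose M := (N + \max_(n < N) B n)%N.
have NM : (N <= M)%N by exact: leq_addr.
have BM n : (n < N)%N -> (B n <= M)%N.
  by move=> nN; rewrite (leq_trans _ (leq_addl _ _)) //; exact: (leq_bigmax (Ordinal nN)).
pose sg v := if v \in U then Num.sqrt (1 + lam v) else 1.
pose s n := if vertex_at n is Some v then sg v else 1.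
have sE v : s (iota v) = sg v by rewrite /s vertex_atK.
have lam1 v : v \in U -> 0 <= 1 + lam v by move=> vU; rewrite addr_ge0 ?lam0.
have sg_gt0 v : 0 < sg v.
  by rewrite /sg; case: ifP => // vU; rewrite sqrtr_gt0 ltr_pwDl ?lam0.
have s_gt0 n : 0 < s n by rewrite /s; case: (vertex_at n).
have sU n : (forall v, v \in U -> iota v <> n) -> s n = 1.
  move=> nU; rewrite /s; case vn : (vertex_at n) => [v|//]; rewrite /sg ifF //.
  by apply/negP => vU; apply: nU vU (vertex_at_Some vn).
have s1 n : (N <= n)%N -> s n = 1.
  by move=> Nn; apply: sU => v /UN /[swap] ->; rewrite ltnNge Nn.
have := laplace_reduction_law nat_conductance_sym nat_conductance_ge0 Bbound s_gt0 s1 NM BM.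
rewrite /reduction_law -QE; first last.
- apply/measurable_EFinP; apply: measurableT_comp => //; apply: measurableT_comp => //.
  by apply: measurable_sum => n; apply: measurable_funM => //; exact: measurable_beta.
- by move=> x; rewrite lee_fin expR_ge0.
- move=> x y xy; congr ((expR (- _))%:E); apply: eq_big_nat => n nN.
  by congr (_ * _); exact: (@beta_dep _ _ N n) xy.
move=> lapE; transitivity (\int[Q]_x
    (expR (- (\sum_(0 <= i < N) (s i ^+ 2 - 1) * beta nat_conductance x i)))%:E)%E.
  apply: eq_integral => x _; congr ((expR (- _))%:E).
  rewrite (big_iota _ iota_inj (U := U)) //; last first.
    by move=> n /sU ->; rewrite expr1n subrr mul0r.
  apply: eq_big_seq => v vU; rewrite sE /sg vU sqr_sqrtr ?lam1 //.
  by rewrite [1 + _]addrC addrK.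
rewrite {}lapE /laplace_nu mulrC; congr ((expR _ / _)%:E); last first.
  rewrite (big_iota _ iota_inj (U := U)) //.
  by apply: eq_big_seq => v vU; rewrite sE /sg vU.
rewrite -opprD; congr (- _).
pose S := (U `|` \bigcup_(u <- U) fset_set [set v | adj G u v])%fset.
have NS u v : u \in U -> adj G u v -> v \in S.
  move=> uU uv; rewrite inE; apply/orP; right; apply/bigfcupP; exists u; first by rewrite uU.
  by rewrite in_fset_set ?inE //; exact: edge_locally_finite.
have SM v : v \in S -> (iota v < M)%N.
  rewrite inE => /orP[/UN vN|/bigfcupP[u /andP[uU _]]]; first exact: leq_trans NM.
  rewrite in_fset_set ?inE; last exact: edge_locally_finite.
  move=> uv; rewrite ltnNge; apply/negP => Mv.
  have := Bbound (iota u) (iota u) (iota v) (leqnn _) (leq_trans (BM _ (UN _ uU)) Mv).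
  by rewrite nat_conductanceE /conductance_op uv => /eqP; rewrite gt_eqF // W_gt0.
have US : (U `<=` S)%fset by exact: fsubsetUl.
(* If n codes no vertex of S then s_n = 1. The conductance vanishes unless m codes a neighbour of n,
   and that neighbour is outside U since S contains all neighbours of U; then s_m = 1 as well. *)
have w0 n m : (forall v, v \in S -> iota v <> n) -> nat_conductance n m * (s n * s m - 1) = 0.
  move=> nS; rewrite (sU n); last by move=> v vU; apply: nS; exact: (fsubsetP US).
  rewrite mul1r /nat_conductance; case vn : (vertex_at n) => [v|]; last by rewrite mul0r.
  rewrite /s; case um : (vertex_at m) => [u|]; last by rewrite mul0r.
  rewrite /sg; case: ifPn => [uU|_]; last by rewrite subrr mulr0.
  rewrite /conductance_op; case: ifPn => [vu|]; last by rewrite mul0r.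
  by case: (nS v) => //; [apply: NS uU _; rewrite adj_sym|exact: vertex_at_Some].
rewrite (big_iota _ iota_inj (U := S)) //; last first.
  by move=> n nS; rewrite big1 // => m _; exact: w0.
under eq_bigr => u _.
  rewrite (big_iota _ iota_inj (U := S)) //; last first.
    move=> n nS; rewrite nat_conductance_sym [s _ * _]mulrC; exact: w0.
  under eq_bigr do rewrite nat_conductanceE !sE.
  over.
by apply: laplace_exponentE => // u uU; rewrite /sg ?uU // (negbTE uU).
Qed.

End existence.

(** Dynkin's argument for one event, the other being fixed; it is applied once to each of the two
    variables. *)
Lemma independent_generated d d1 (T : measurableType d) (T1 : measurableType d1)
    (R : realType) (P : probability T R) (X : T -> T1) (C : set T) (G : set (set T1)) :
  @measurable _ T1 = <<s G >> -> setI_closed G -> measurable_fun setT X ->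
  measurable C ->
  (forall A, G A -> P (X @^-1` A `&` C) = P (X @^-1` A) * P C)%E ->
  forall A, measurable A -> (P (X @^-1` A `&` C) = P (X @^-1` A) * P C)%E.
Proof.
move=> GE GI mX mC GP A; rewrite {1}GE.
have mXA B : measurable B -> measurable (X @^-1` B).
  by move=> mB; rewrite -[X in measurable X]setTI; exact: mX.
move: A; apply: (dynkin_induction GE GI) => //.
- by rewrite preimage_setT setTI probability_setT mul1e.
- move=> B mB PB; have mXB := mXA _ mB.
  have CD : (P (C `\` X @^-1` B) = P C - P (C `&` X @^-1` B))%E.
    by apply: measureD => //; rewrite -ge0_fin_numE // fin_num_measure.
  rewrite (_ : X @^-1` (~` B) = ~` (X @^-1` B)) // setIC -setDE CD setIC PB probability_setC //.
  by rewrite muleBl ?mul1e // ?fin_num_measure // fin_num_adde_defr // fin_num_measure.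
- move=> F mF tF PF.
  have tXF : trivIset setT (fun k => X @^-1` F k).
    apply/trivIsetP => i j _ _ ij; rewrite -preimage_setI.
    by move/trivIsetP : tF => ->//; rewrite preimage_set0.
  have mXF k : measurable (X @^-1` F k) by exact: mXA.
  have mXC k : measurable (X @^-1` F k `&` C) by exact: measurableI.
  rewrite preimage_bigcup setI_bigcupl.
  rewrite measure_semi_bigcup //; [|exact: trivIset_setIr|exact: bigcupT_measurable].
  rewrite measure_semi_bigcup //; last exact: bigcupT_measurable.
  rewrite muleC -[P C]fineK ?fin_num_measure // -nneseriesZl //.
  by apply: eq_eseriesr => k _; rewrite fineK ?fin_num_measure // muleC; exact: PF.
Qed.

(** * Uniqueness *)

Section field_law.
Variables (R : realType) (V : choiceType) (G : graph V) (W : {fset V} -> R).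
Local Notation D := (borel (DV G W)).

(** The 1 x 1 minor of H_beta at i is 2 beta_i, the graph having no loops. This positivity opens the
    way to [laplace_box_unique]. *)
Lemma DV_gt0 (b : DV G W) i : 0 < val b i.
Proof.
have := set_mem (valP b) [fset i]%fset (fun=> 1).
have i_in : i \in [fset i]%fset by rewrite inE.
move=> /(_ (ex_intro _ [` i_in]%fset (oner_neq0 _))).
under eq_bigr do under eq_bigr do rewrite mul1r mulr1.
under eq_bigr do rewrite -(big_seq_fsetE _ [fset i]%fset predT (fun v => schrodinger_op G W
  (val b) _ v)) /=.
rewrite -(big_seq_fsetE _ [fset i]%fset predT (fun u => \sum_(v <- [fset i]%fset)
  schrodinger_op G W (val b) u v)) /=.
rewrite !big_seq_fset1 /schrodinger_op /conductance_op adj_irrefl oppr0 add0r eqxx mulr1n.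
by rewrite pmulr_rgt0.
Qed.

Variables (iota : V -> nat) (iota_inj : injective iota).

Lemma measurable_DV_coord i : measurable_fun setT (fun b : D => val b i).
Proof.
exact: (@measurable_coord R (vertex_countType iota_inj) (DV G W) _ (fun b => val b) (@open_DV R
  V G W)).
Qed.

(** A vertex may be listed several times in t; its exponents add up to lambda_v. *)
Definition lap_weight (t : seq (V * nat)) (v : V) : R :=
  \sum_(p <- t | p.1 == v) p.2%:R.

Definition lap_support (t : seq (V * nat)) : {fset V} := [fset x in map fst t]%fset.

Lemma lap_weight_ge0 t v : 0 <= lap_weight t v.
Proof. exact: sumr_ge0. Qed.

Lemma sum_lap_weight t (c : V -> R) :
  \sum_(p <- t) p.2%:R * c p.1 = \sum_(v <- lap_support t) lap_weight t v * c v.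
Proof.
under [RHS]eq_bigr do rewrite mulr_suml big_mkcond.
rewrite exchange_big /=; apply: eq_big_seq => p pt.
have ps : p.1 \in lap_support t by rewrite inE map_f.
rewrite (big_fsetD1 _ ps) /= eqxx big1_seq ?addr0 // => v.
by rewrite !inE eq_sym => /andP[_ /andP[/negbTE -> _]].
Qed.

(** Only the values of [lam] on the support are prescribed, so that a single [lam] serves for both
    parts of a list in [integral_lap_joint]. *)
Lemma integral_lap (nu : probability D R) t (lam : V -> R) : has_laplace_nu nu ->
  (forall v, v \in lap_support t -> lam v = lap_weight t v) ->
  (\int[nu]_b (lap t (val b))%:E = (laplace_nu G W (lap_support t) lam)%:E)%E.
Proof.
move=> nuL lamE; rewrite -nuL => [|v /lamE ->]; last exact: lap_weight_ge0.
apply: eq_integral => b _; rewrite /lap sum_lap_weight; congr ((expR (- _))%:E).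
by apply: eq_big_seq => v /lamE ->.
Qed.

Lemma field_law_unique (nu nu' : probability D R) :
  has_laplace_nu nu -> has_laplace_nu nu' -> forall A, measurable A -> nu' A = nu A.
Proof.
move=> nuL nuL'.
apply: (@borel_measure_unique R (vertex_countType iota_inj) (DV G W) _ (fun b => val b)
  (@open_DV R V G W)) => s.
apply: (@laplace_box_unique R V _ _ _ _ nu' nu (fun b => val b) (fun b => val b)).
- exact: measurable_DV_coord.
- by move=> b i; exact: DV_gt0.
- exact: measurable_DV_coord.
- by move=> b i; exact: DV_gt0.
by move=> t; rewrite !(@integral_lap _ t (lap_weight t)).
Qed.

(** * Reciprocal inverse Gaussian marginals *)

Section marginal.
Hypothesis W_gt0 : forall e, edge G e -> 0 < W e.

Lemma total_conductance_ge0 i : 0 <= total_conductance G W i.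
Proof.
rewrite /total_conductance fsbig_finite; last exact: edge_locally_finite.
rewrite big_seq; apply: sumr_ge0 => j; rewrite in_fset_set; last exact: edge_locally_finite.
by rewrite inE => /W_gt0 /ltW.
Qed.

Lemma laplace_nu1 i (lam : R) : laplace_nu G W [fset i]%fset (fun=> lam) =
  expR (total_conductance G W i - total_conductance G W i * Num.sqrt (1 + lam)) / Num.sqrt (1 +
    lam).
Proof.
rewrite /laplace_nu !big_seq_fset1; congr (expR _ / _).
rewrite fpowerset1 big_mkcond big_fsetU1 /= ?big_seq_fset1; last first.
  by rewrite inE; apply/eqP => /fsetP /(_ i); rewrite !inE eqxx.
have -> : edge G fset0 = false by apply/negP => /edge_card2; rewrite cardfs0.
have -> : edge G [fset i]%fset = false by apply/negP => /edge_card2; rewrite cardfs1.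
rewrite addr0 oppr0 add0r.
have -> : [set j | adj G i j /\ j \notin [fset i]%fset] = [set j | adj G i j].
  apply/seteqP; split => j /=; first by case.
  by move=> ij; split => //; rewrite inE; apply: contraTneq ij => ->; rewrite adj_irrefl.
rewrite /total_conductance !fsbig_finite /=; try exact: edge_locally_finite.
by rewrite -mulr_suml; ring.
Qed.

(** For mu = 1 / c one has (x - mu)^2 / (2 mu^2 x) = (c x - 1)^2 / (2 x); the extended inverse sends
    c = 0 to mu = +oo, where the limit density is [igf 0 1]. *)
Lemma inverse_gaussian_pdfE (c x : R) : 0 <= c ->
  inverse_gaussian_pdf (c%:E^-1)%E 1 x = igf c 1 x.
Proof.
move=> c0; rewrite /inverse_gaussian_pdf /igf; case: leP => // x0.
have [->|cn] := eqVneq c 0.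
  by rewrite inve0; congr (_ * expR (- _)); rewrite mul0r sub0r sqrrN expr1n.
rewrite inver (negbTE cn); congr (_ * expR (- _)).
by field; rewrite cn gt_eqF.
Qed.

(** The transform given by [laplace_nu1] is that of 1 / (2 x) under [igf c 1], by the tilt with a =
    b = c. Equality on boxes for beta_i is then carried to 1 / (2 beta_i) on the rays []-oo, x[],
    which generate. *)
Lemma field_law_marginal (nu : probability D R) i : has_laplace_nu nu ->
  has_inverse_gaussian_law nu (fun b => 1 / (2 * val b i))
          ((total_conductance G W i)%:E^-1)%E 1.
Proof.
move=> nuL; set c := total_conductance G W i.
have c0 : 0 <= c by exact: total_conductance_ge0.
have mX : measurable_fun setT ((fun b => 1 / (2 * val b i)) : D -> measurableTypeR R).
  apply: measurable_funM => //; apply: (measurableT_comp (@measurable_invr R)).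
  by apply: measurable_funM => //; exact: measurable_DV_coord.
split => //.
pose f : measurableTypeR R -> R := igf c 1.
have f0 x : 0 <= f x by exact: igf_ge0.
have mf : measurable_fun setT f by exact: measurable_igf.
have f1 : (\int[lebesgue_measure]_x (f x)%:E = 1)%E.
  by rewrite [LHS]integralT_igf // invr1.
have [P [PE PI]] := exists_density f0 mf f1.
(* The value 1 for x <= 0, a null set for P, keeps Y positive everywhere. *)
pose Y (x : measurableTypeR R) (_ : unit) : R := if x <= 0 then 1 else (2 * x)^-1.
have mY u : measurable_fun setT (fun x => Y x u).
  rewrite /Y; apply: measurable_fun_ifT => //=; first exact: measurable_fun_ler.
  by apply: (measurableT_comp (@measurable_invr R)); exact: measurable_funM.
have Y0 x u : 0 < Y x u.
  rewrite /Y; have [x0|x0] := leP x 0; first exact: ltr01.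
  by rewrite invr_gt0 mulr_gt0.
have box1 : forall s, nu [set b | box s (fun _ : unit => val b i)] = P [set x | box s (Y x)].
  apply: (@laplace_box_unique R unit _ _ _ _ nu P (fun b _ => val b i) Y) => //.
  - by move=> _; exact: measurable_DV_coord.
  - by move=> b _; exact: DV_gt0.
  move=> t; pose lam : R := \sum_(p <- t) p.2%:R.
  have lam0 : 0 <= lam by exact: sumr_ge0.
  have s0 : 0 < Num.sqrt (1 + lam) by rewrite sqrtr_gt0 ltr_pwDl.
  transitivity (laplace_nu G W [fset i]%fset (fun=> lam))%:E.
    rewrite -nuL //; apply: eq_integral => b _.
    by rewrite /lap big_seq_fset1 mulr_suml.
  rewrite laplace_nu1 -(integral_igf_tilt c c0 s0) PI; last 2 first.
  - by move=> x; rewrite lee_fin expR_ge0.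
  - apply/measurable_EFinP; apply: measurableT_comp => //; apply: measurableT_comp => //.
    by apply: measurable_sum => p; exact: measurable_funM.
  apply: eq_integral => x _; rewrite /f -EFinM; congr (_%:E); rewrite [RHS]mulrC.
  have [x0|x0] := leP x 0; first by rewrite /igf x0 !mul0r.
  rewrite subrr !mul0r subr0; congr (_ * expR (- _)).
  rewrite sqr_sqrtr ?addr_ge0 // [1 + _]addrC addrK mulr_suml.
  by apply: eq_bigr => p _; rewrite /Y leNgt x0.
have [Q [QA _]] := exists_pushforward nu mX.
have QP A : measurable A -> Q A = P A.
  move: A; apply: (@measure_unique _ R (measurableTypeR R) _
    (fun k => `]-oo, k%:R[%classic) (RGenInftyO.measurableE R)).
  - move=> _ _ [x ->] [y ->]; exists (Num.min x y).
    by apply/seteqP; split => z /=; rewrite !in_itv /= lt_min => /andP.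
  - by move=> k; exists k%:R.
  - by apply/seteqP; split => // x _; exists (Num.truncn `|x|).+1 => //=;
      rewrite in_itv /= (le_lt_trans (ler_norm _)) // truncnS_gt.
  - move=> _ [x ->]; apply: (etrans (QA _ (measurable_itv _)));
    apply: etrans _ (esym (PE _ (measurable_itv _))).
    have [x0|x0] := leP x 0.
      rewrite [RHS]integral0_eq.
        rewrite (_ : _ @^-1` _ = set0) ?measure0 //.
        apply/seteqP; split => // b /=; rewrite in_itv /= => bx.
        have := lt_le_trans bx x0; rewrite ltNge => /negP; apply.
        by rewrite divr_ge0 // mulr_ge0 // ltW // DV_gt0.
      move=> y /=; rewrite in_itv /= => yx.
      by rewrite /f /igf (le_trans (ltW yx) x0).
    have := box1 [:: (tt, (2 * x)^-1)].
    rewrite PE; last first.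
      rewrite (_ : [set _ | _] = (fun y => Y y tt) @^-1` `](2 * x)^-1, +oo[%classic).
        by rewrite -[X in measurable X]setTI; apply: mY => //; exact: measurable_itv.
      by apply/seteqP; split => y /=; rewrite /box in_itv /= !andbT.
    move=> nuE; transitivity (nu [set b : D | box [:: (tt, (2 * x)^-1)] (fun _ : unit => val b
      i)]).
      apply: (congr1 (fun A : set D => nu A)).
      have e (b : D) : (1 / (2 * val b i) < x) = ((2 * x)^-1 < val b i).
        by rewrite -[(2 * x)^-1]div1r !ltr_pdivrMr ?mulr_gt0 ?DV_gt0 // mulrCA (mulrC x) mulrCA.
      by apply/seteqP; split => b /=; rewrite /box in_itv /= andbT e.
    rewrite nuE [LHS]integral_mkcond [RHS]integral_mkcond.
    apply: eq_integral => y _; rewrite !patchE /f.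
    have [y0|y0] := leP y 0; first by rewrite /igf y0 !if_same.
    congr (if _ then _ else _); apply/idP/idP => /set_mem /= h; apply/mem_set => /=.
      move: h; rewrite /box /= /Y leNgt y0 /= andbT in_itv /=.
      by rewrite ltf_pV2 ?posrE ?mulr_gt0 // ltr_pM2l.
    by move: h; rewrite /box /= /Y leNgt y0 /= andbT in_itv /= ltf_pV2 ?posrE ?mulr_gt0 //
      ltr_pM2l.
  - by move=> k; rewrite -ge0_fin_numE // fin_num_measure //; exact: measurable_itv.
move=> A mA; rewrite /pushforward -QA // QP // PE //.
by apply: eq_integral => x _; rewrite inverse_gaussian_pdfE.
Qed.
End marginal.
End field_law.

(** * 1-dependence *)

Section independence.
Variables (R : realType) (V : choiceType) (G : graph V) (W : {fset V} -> R).
Local Notation D := (borel (DV G W)).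

Lemma set_dist_ge2 (U U' : set V) u v : (2%:E <= set_dist G R U U')%E ->
  U u -> U' v -> u != v /\ ~~ adj G u v.
Proof.
move=> dU Uu Uv.
have path_ge2 p : path (adj G) u p -> last u p = v -> (1 < size p)%N.
  move=> up pv; have : (2%:E <= (size p)%:R%:E :> \bar R)%E.
    apply: (le_trans dU); apply: (@le_trans _ _ (dist G R u v)); apply: ereal_inf_lbound.
      by exists u => //; exists v.
    by exists p.
  by rewrite lee_fin ler_nat.
split; apply/negP.
  by move=> /eqP uv; have := path_ge2 [::] isT uv.
by move=> uv; have := path_ge2 [:: v]; rewrite /= uv => /(_ isT erefl).
Qed.

(** In the form of [laplace_exponentE], sg for U is the product of sg for U1 and sg for U2. No edge
    joins U1 to U2, so along an edge one of the two factors is 1 at both ends, and the terms s_u s_v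
    - 1 add up. *)
Lemma laplace_nu_split (U U1 : {fset V}) (lam : V -> R) :
  (U1 `<=` U)%fset -> (forall u, u \in U -> 0 <= lam u) ->
  (forall u v, u \in U1 -> v \in (U `\` U1)%fset -> ~~ adj G u v) ->
  laplace_nu G W U lam = laplace_nu G W U1 lam * laplace_nu G W (U `\` U1)%fset lam.
Proof.
set U2 := (U `\` U1)%fset => U1U lam0 far.
have U2U : (U2 `<=` U)%fset by exact: fsubsetDl.
pose sg (A : {fset V}) u : R := if u \in A then Num.sqrt (1 + lam u) else 1.
pose S := (U `|` \bigcup_(u <- U) fset_set [set v | adj G u v])%fset.
have NS u v : u \in U -> adj G u v -> v \in S.
  move=> uU uv; rewrite inE; apply/orP; right; apply/bigfcupP; exists u; first by rewrite uU.
  by rewrite in_fset_set ?inE //; exact: edge_locally_finite.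
have US : (U `<=` S)%fset by exact: fsubsetUl.
have lapE (A : {fset V}) : (A `<=` U)%fset -> laplace_nu G W A lam =
    expR (- ((\sum_(u <- S) \sum_(v <- S) conductance_op G W u v * (sg A u * sg A v - 1)) / 2)) *
    (\prod_(i <- A) Num.sqrt (1 + lam i))^-1.
  move=> /fsubsetP AU; rewrite /laplace_nu -opprD; congr (expR (- _) / _).
  apply/esym/laplace_exponentE.
  - by apply/fsubsetP => u /AU; exact/fsubsetP.
  - by move=> u v /AU; exact: NS.
  - by move=> u /AU; exact: lam0.
  - by move=> u uA; rewrite /sg uA.
  - by move=> u uA; rewrite /sg (negbTE uA).
rewrite !lapE // mulrACA -expRD -invfM; congr (expR _ / _); last first.
  rewrite (big_fsetID _ (mem U1)) /=; congr (_ * _); congr (bigop _ _); congr enum_fset;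
    apply/fsetP => x; rewrite !inE; last by rewrite andbC.
  by rewrite andb_idl //; exact: (fsubsetP U1U).
rewrite -opprD -mulrDl -big_split /=; congr (- (_ / _)).
apply: eq_bigr => u _; rewrite -big_split /=; apply: eq_bigr => v _.
rewrite /conductance_op; case: ifPn => [uv|_]; last by rewrite !mul0r addr0.
rewrite -mulrDr; congr (_ * _).
have e w : sg U w = sg U1 w * sg U2 w.
  rewrite /sg /U2 inE; have [w1|w1] := boolP (w \in U1); last by rewrite mul1r.
  by rewrite (fsubsetP U1U _ w1) mulr1.
have disj x y : adj G x y -> x \in U1 -> (x \notin U2) && (y \notin U2).
  move=> xy x1; apply/andP; split; first by rewrite inE x1.
  by apply: contraTN xy => y2; exact: far.
have [u1|u1] := boolP (u \in U1).
  have /andP[u2 v2] := disj _ _ uv u1.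
  by rewrite !e [sg U2 u]ifN // [sg U2 v]ifN // !mulr1 subrr addr0.
have [v1|v1] := boolP (v \in U1).
  have /andP[v2 u2] := disj v u (etrans (adj_sym _ _ _) uv) v1.
  by rewrite !e [sg U2 u]ifN // [sg U2 v]ifN // !mulr1 subrr addr0.
by rewrite !e [sg U1 u]ifN // [sg U1 v]ifN // !mul1r subrr add0r.
Qed.

Variables (iota : V -> nat) (iota_inj : injective iota).

Lemma iota_val_inj (U : set V) : injective (iota \o (val : U -> V)).
Proof. by move=> x y /iota_inj /val_inj. Qed.

Lemma measurable_restriction (U : set V) :
  measurable_fun setT (@restriction R V G W U).
Proof.
apply: (@measurable_to_borel R (vertex_countType (@iota_val_inj U)) _ _ id (@open_ptws_id R U))
  => i.
exact: (@measurable_DV_coord R V G W iota iota_inj (val i)).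
Qed.

Section far_apart.
Variables (nu : probability D R) (U U' : set V).
Hypotheses (nuL : has_laplace_nu nu) (dU : (2%:E <= set_dist G R U U')%E).

Definition joint_vertex (i : U + U') : V :=
  match i with inl u => val u | inr u => val u end.

(** Under the product of nu with itself: two independent copies of the field, one read on U, the
    other on U'. *)
Definition joint_field (z : D * D) (i : U + U') : R :=
  match i with inl u => val z.1 (val u) | inr u => val z.2 (val u) end.

Definition lap_part (b : bool) (t : seq ((U + U') * nat)) : seq (V * nat) :=
  [seq (joint_vertex p.1, p.2) | p <- t & is_inl p.1 == b].

Lemma sum_lap_part b t (c : V -> R) :
  \sum_(p <- lap_part b t) p.2%:R * c p.1 =
  \sum_(p <- t | is_inl p.1 == b) p.2%:R * c (joint_vertex p.1).
Proof. by rewrite /lap_part big_map big_filter. Qed.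

Lemma lap_part_sub t v :
  (v \in lap_support (lap_part true t) -> U v) /\
  (v \in lap_support (lap_part false t) -> U' v).
Proof.
by split; rewrite inE => /mapP[q /mapP[[[u|u] n]]] /=; rewrite mem_filter //= => _ -> -> /=;
  exact: set_valP.
Qed.

(** The supports of the two parts of t are disjoint and not linked, so the Laplace transform
    factorizes by [laplace_nu_split]; Fubini turns the product into an integral for the product
    measure. *)
Lemma integral_lap_joint t :
  (\int[nu]_b (lap t (fun i => val b (joint_vertex i)))%:E =
   \int[nu \x nu]_z (lap t (joint_field z))%:E)%E.
Proof.
pose t1 := lap_part true t; pose t2 := lap_part false t.
pose lam := lap_weight R (t1 ++ t2).
have ml s : measurable_fun setT (fun b : D => (lap s (val b))%:E).
  apply/measurable_EFinP; apply: measurableT_comp => //; apply: measurableT_comp => //.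
  by apply: measurable_sum => p; apply: measurable_funM => //;
    exact: (@measurable_DV_coord R V G W iota iota_inj).
have splitE (c c' : V -> R) (f : U + U' -> R) :
    (forall u, f (inl u) = c (val u)) -> (forall u, f (inr u) = c' (val u)) ->
    lap t f = lap t1 c * lap t2 c'.
  move=> fc fc'; rewrite /lap -expRD -opprD !sum_lap_part (bigID (fun p => is_inl p.1)) /=.
  set l := \sum_(p <- t | is_inl p.1) _; set r := \sum_(p <- t | ~~ is_inl p.1) _.
  have -> : l = \sum_(p <- t | is_inl p.1 == true) p.2%:R * c (joint_vertex p.1).
    by apply: eq_big => [p|[[u|//] n] _]; [rewrite eqb_id|rewrite fc].
  have -> // : r = \sum_(p <- t | is_inl p.1 == false) p.2%:R * c' (joint_vertex p.1).
  by apply: eq_big => [p|[[//|u] n] _]; [rewrite eqbF_neg|rewrite fc'].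
have far u v : u \in lap_support t1 -> v \in lap_support t2 -> u != v /\ ~~ adj G u v.
  by move=> /(lap_part_sub t u).1 Uu /(lap_part_sub t v).2 Uv; exact: set_dist_ge2 dU Uu Uv.
have wE (s s' : seq (V * nat)) v : (forall u, u \in lap_support s -> v != u) -> lap_weight R (s
  ++ s') v = lap_weight R s' v /\
    lap_weight R (s' ++ s) v = lap_weight R s' v.
  move=> vs; have s0 : lap_weight R s v = 0.
    rewrite /lap_weight big_seq_cond big_pred0 // => p; apply/negP => /andP[ps /eqP pv].
    by have := vs p.1; rewrite inE map_f // pv eqxx => /(_ isT).
  by rewrite /lap_weight !big_cat /= -!/(lap_weight _ _ _) s0 add0r addr0.
have lhs : (\int[nu]_b (lap t (fun i => val b (joint_vertex i)))%:E =
    (laplace_nu G W (lap_support (t1 ++ t2)) lam)%:E)%E.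
  rewrite -(@integral_lap _ _ _ _ nu) //; apply: eq_integral => b _; congr (_%:E).
  by rewrite (splitE (val b) (val b)) // /lap big_cat opprD expRD.
have s1 : (lap_support t1 `<=` lap_support (t1 ++ t2))%fset.
  by apply/fsubsetP => v; rewrite !inE map_cat mem_cat => ->.
have s2 : (lap_support (t1 ++ t2) `\` lap_support t1)%fset = lap_support t2.
  have catE v : (v \in lap_support (t1 ++ t2)) = (v \in lap_support t1) || (v \in lap_support t2).
    by rewrite !inE map_cat mem_cat.
  apply/fsetP => v; rewrite in_fsetD catE; have [v1|//] := boolP (v \in lap_support t1).
  by apply/esym/negP => v2; have [/eqP] := far _ _ v1 v2.
rewrite lhs (laplace_nu_split s1); last 2 first.
- by move=> u _; exact: lap_weight_ge0.
- by rewrite s2 => u v u1 v2; have [] := far _ _ u1 v2.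
rewrite s2 EFinM -(@integral_lap _ _ _ _ nu t1) //; last first.
  move=> v v1; have [] := @wE t2 t1 v => // u u2.
  by have [] := far _ _ v1 u2.
rewrite -(@integral_lap _ _ _ _ nu t2) //; last first.
  move=> v v2; have [] := @wE t1 t2 v => // u u1.
  by have [] := far _ _ u1 v2; rewrite eq_sym.
have l0 s (b : D) : (0 <= (lap s (val b))%:E :> \bar R)%E by rewrite lee_fin expR_ge0.
under [RHS]eq_integral => z _.
  rewrite (splitE (val z.1) (val z.2)) // EFinM.
  over.
rewrite fubini_tonelli1 /=; last 2 first.
- by apply: emeasurable_funM; apply: (measurableT_comp (ml _)).
- by move=> z; apply: mule_ge0; exact: l0.
rewrite /fubini_F /=.
pose c := (\int[nu]_b (lap t2 (val b))%:E)%E.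
have c0 : (0 <= c)%E by apply: integral_ge0 => b _; exact: l0.
transitivity (\int[nu]_b ((lap t1 (val b))%:E * c))%E.
  by rewrite ge0_integralZr // => b _; exact: l0.
apply: eq_integral => b _; rewrite ge0_integralZl //.
- by move=> b' _; exact: l0.
- exact: l0.
Qed.

(** [laplace_box_unique], over the disjoint sum of U and U', identifies on boxes the law of the pair
    under nu with its law under the product measure, where a box is a rectangle. *)
Lemma restriction_box_independent (s : seq (U * R)) (s' : seq (U' * R)) :
  (nu (@restriction R V G W U @^-1` box s `&` @restriction R V G W U' @^-1` box s') =
   nu (@restriction R V G W U @^-1` box s) * nu (@restriction R V G W U' @^-1` box s'))%E.
Proof.
have mbox U0 (s0 : seq (set_type U0 * R)) : measurable (@restriction R V G W U0 @^-1` box s0).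
  rewrite -[X in measurable X]setTI; apply: measurable_restriction => //.
  exact: (@measurable_box R (vertex_countType (@iota_val_inj U0)) _ _ id (@open_ptws_id R U0)).
pose S : seq ((U + U') * R) := [seq (inl p.1, p.2) | p <- s] ++ [seq (inr p.1, p.2) | p <- s'].
have boxE (f : U + U' -> R) : box S f <-> box s (f \o inl) /\ box s' (f \o inr).
  rewrite /box /S /= all_cat !all_map; split; first by move=> /andP.
  by move=> [h1 h2]; apply/andP.
rewrite -product_measure1E //.
have mX i : measurable_fun setT (fun b : D => val b i).
  exact: (@measurable_DV_coord R V G W iota iota_inj).
have := @laplace_box_unique R (U + U')%type _ _ _ _ nu (nu \x nu)%E
  (fun b i => val b (joint_vertex i)) joint_field _ _ _ _ integral_lap_joint S.
rewrite (_ : [set u | _] = @restriction R V G W U @^-1` box s `&` @restriction R V G W U' @^-1`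
  box s'); last first.
  by apply/seteqP; split => b h; [exact: (boxE _).1 h|exact: (boxE _).2 h].
rewrite (_ : [set u | _] = (@restriction R V G W U @^-1` box s) `*` (@restriction R V G W U'
  @^-1` box s')); last first.
  by apply/seteqP; split => z h; [exact: (boxE (joint_field z)).1 h|exact: (boxE (joint_field
    z)).2 h].
apply.
- by move=> i; exact: mX.
- by move=> b i; exact: DV_gt0.
- move=> [u|u] /=; first exact: (measurableT_comp (mX _) measurable_fst).
  exact: (measurableT_comp (mX _) measurable_snd).
- by move=> z [u|u]; exact: DV_gt0.
Qed.

Lemma field_law_independent :
  independent_rv nu (@restriction R V G W U) (@restriction R V G W U').
Proof.
split; [exact: measurable_restriction|exact: measurable_restriction|].
pose I0 (U0 : set V) : countType := vertex_countType (@iota_val_inj U0).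
pose boxes (U0 : set V) : set (set (set_type U0 -> R)) := [set box s | s in [set: seq (set_type
  U0 * R)]].
have boxesE (U0 : set V) : @measurable _ (borel {ptws U0 -> R}) = <<s boxes U0 >>.
  exact: (@borel_box R (I0 U0) _ _ id (@open_ptws_id R U0)).
have boxesI (U0 : set V) : setI_closed (boxes U0).
  by move=> _ _ [s _ <-] [t _ <-]; exists (s ++ t) => //; rewrite box_cat.
have mrestr (U0 : set V) B : measurable B -> measurable (@restriction R V G W U0 @^-1` B).
  by move=> mB; rewrite -[X in measurable X]setTI; exact: measurable_restriction.
have mbox (U0 : set V) B : boxes U0 B -> @measurable _ (borel {ptws U0 -> R}) B.
  by move=> bB; rewrite boxesE; exact: sub_sigma_algebra.
move=> A B mA mB.
apply: (independent_generated (boxesE U) (boxesI U) (measurable_restriction (U:=U))) => //.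
  exact: mrestr.
move=> A' A'b; rewrite setIC muleC.
apply: (independent_generated (boxesE U') (boxesI U') (measurable_restriction (U:=U'))) => //.
  by apply: mrestr; exact: mbox.
move=> B' [s' _ <-]; case: A'b => s _ <-.
by rewrite setIC muleC; exact: restriction_box_independent.
Qed.

End far_apart.
End independence.

Theorem proposition1 (R : realType) (V : choiceType) (G : graph V)
    (W : {fset V} -> R) (W_gt0 : forall e, edge G e -> 0 < W e) :
  exists nu : probability (borel (DV G W)) R,
  [/\ has_laplace_nu nu,
      forall nu' : probability (borel (DV G W)) R, has_laplace_nu nu' ->
        forall A, measurable A -> nu' A = nu A,
      forall U U' : set V, (2%:E <= set_dist G R U U')%E ->
        independent_rv nu (@restriction R V G W U) (@restriction R V G W U') &
      forall i : V,
        has_inverse_gaussian_law nu (fun b => 1 / (2 * val b i))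
          ((total_conductance G W i)%:E^-1)%E 1].
Proof.
have [iota iota_inj] := graph_countable G.
have [nu nuL] := exists_field_law W_gt0 iota_inj.
exists nu; split => //.
- by move=> nu' nuL'; exact: (field_law_unique iota_inj).
- by move=> U U'; exact: (field_law_independent iota_inj).
- by move=> i; exact: (field_law_marginal iota_inj).
Qed.
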